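(* Let $p$ be an odd prime and let $F=\langle x,y \mid x^p, y^p\rangle$ be the free product of two cyclic groups of order $p$. Let $k\geq 1$ be an integer and put $i=k(p-1)+1$. Then the quotient $F/\gamma_{i+1}(F)$ is a strongly real Beauville group.
   Context: $\gamma_n(F)$ denotes the $n$-th term of the lower central series of $F$, with $\gamma_1(F)=F$ and $\gamma_{n+1}(F)=[\gamma_n(F),F]$. For a finite group $G$ and $x,y\in G$, define $$\Sigma(x,y)=\bigcup_{g\in G}\big(\langle x\rangle^g\cup\langle y\rangle^g\cup\langle xy\rangle^g\big),$$ the union of all subgroups of $G$ conjugate to $\langle x\rangle$, to $\langle y\rangle$ or to $\langle xy\rangle$. A finite group $G$ is a Beauville group if $G$ is a $2$-generator group and there exists a pair of generating sets $\{x_1,y_1\}$ and $\{x_2,y_2\}$ of $G$ such that $\Sigma(x_1,y_1)\cap\Sigma(x_2,y_2)=1$ (i.e. the intersection is $\{1\}$). Such a pair $\{\{x_1,y_1\},\{x_2,y_2\}\}$ is called a Beauville structure for $G$. A Beauville group $G$ is strongly real if there exists a Beauville structure $\{\{x_1,y_1\},\{x_2,y_2\}\}$ for $G$, an automorphism $\theta\in\operatorname{Aut}(G)$ and elements $g_1,g_2\in G$ such that $g_j\theta(x_j)g_j^{-1}=x_j^{-1}$ and $g_j\theta(y_j)g_j^{-1}=y_j^{-1}$ for $j=1,2$. *)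

(* Defs.v *)
From HB Require Import structures.
From mathcomp Require Import all_boot all_order all_fingroup.
From mathcomp Require Import boolp classical_sets.

Set Implicit Arguments.
Unset Strict Implicit.
Unset Printing Implicit Defensive.

Local Open Scope group_scope.
Local Open Scope quotient_scope.

(* fingroup also defines a repr, on sets of group elements *)
Local Notation repr := generic_quotient.repr.

Section Presentation.
Variables (X : choiceType) (R : set (seq (X * bool))).

(* A word over X is a list of letters: (x, true) is the generator x and
   (x, false) its formal inverse. *)
Inductive pres_eq : seq (X * bool) -> seq (X * bool) -> Prop :=
| pres_eq_refl u : pres_eq u u
| pres_eq_sym u v : pres_eq u v -> pres_eq v u
| pres_eq_trans v u w : pres_eq u v -> pres_eq v w -> pres_eq u w
| pres_eq_cat u u' v v' :
    pres_eq u u' -> pres_eq v v' -> pres_eq (u ++ v) (u' ++ v')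
| pres_eq_cancel x b : pres_eq [:: (x, b); (x, ~~ b)] [::]
| pres_eq_rel r : R r -> pres_eq r [::].

Definition pres_eqb : rel (seq (X * bool)) := fun u v => `[< pres_eq u v >].

Fact pres_eqb_refl : reflexive pres_eqb.
Proof. by move=> u; apply/asboolP; apply: pres_eq_refl. Qed.

Fact pres_eqb_sym : symmetric pres_eqb.
Proof. by move=> u v; apply/asboolP/asboolP; apply: pres_eq_sym. Qed.

Fact pres_eqb_trans : transitive pres_eqb.
Proof.
by move=> v u w /asboolP uv /asboolP vw; apply/asboolP/(pres_eq_trans uv vw).
Qed.

Canonical pres_equiv :=
  EquivRel pres_eqb pres_eqb_refl pres_eqb_sym pres_eqb_trans.

(* The group < X | R >, each word of R being read as the relation r = 1. *)
Definition presented := {eq_quot pres_eqb}.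
HB.instance Definition _ : EqQuotient _ pres_eqb presented :=
  EqQuotient.on presented.
HB.instance Definition _ := Choice.on presented.

Definition word_inv (u : seq (X * bool)) : seq (X * bool) :=
  rev [seq (a.1, ~~ a.2) | a <- u].

Lemma word_invK : involutive word_inv.
Proof.
move=> u; rewrite /word_inv map_rev revK -map_comp -[RHS]map_id.
by apply: eq_map => -[x b] /=; rewrite negbK.
Qed.

Lemma word_inv_cat u v : word_inv (u ++ v) = word_inv v ++ word_inv u.
Proof. by rewrite /word_inv map_cat rev_cat. Qed.

Lemma word_catV u : pres_eq (u ++ word_inv u) [::].
Proof.
elim: u => [|[x b] u IHu]; first exact: pres_eq_refl.
rewrite -cat1s word_inv_cat -catA (catA u).
apply: (pres_eq_trans (v := [:: (x, b)] ++ ([::] ++ [:: (x, ~~ b)]))).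
  apply: pres_eq_cat; first exact: pres_eq_refl.
  by apply: pres_eq_cat IHu _; apply: pres_eq_refl.
exact: pres_eq_cancel.
Qed.

Lemma word_catVl u : pres_eq (word_inv u ++ u) [::].
Proof. by rewrite -{2}[u]word_invK; apply: word_catV. Qed.

Lemma pres_eq_inv u v : pres_eq u v -> pres_eq (word_inv u) (word_inv v).
Proof.
move=> uv; apply: (pres_eq_trans (v := word_inv u ++ (v ++ word_inv v))).
  rewrite -{1}[word_inv u]cats0; apply: pres_eq_cat; first exact: pres_eq_refl.
  exact/pres_eq_sym/word_catV.
rewrite catA -{2}[word_inv v]cat0s.
apply: pres_eq_cat; last exact: pres_eq_refl.
apply: pres_eq_trans (word_catVl u).
by apply: pres_eq_cat (pres_eq_sym uv); apply: pres_eq_refl.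
Qed.

Lemma pres_piP u v : reflect (pres_eq u v) (\pi_presented u == \pi_presented v).
Proof. by rewrite eqmodE; apply: asboolP. Qed.

Lemma pres_repr u : pres_eq (repr (\pi_presented u)) u.
Proof. by apply/pres_piP; rewrite reprK. Qed.

Definition pres_one : presented :=
  \pi_presented [::].
Definition pres_mul (a b : presented) : presented :=
  \pi_presented (repr a ++ repr b).
Definition pres_inv (a : presented) : presented :=
  \pi_presented (word_inv (repr a)).

Lemma pres_mulE u v :
  pres_mul (\pi_presented u) (\pi_presented v) = \pi_presented (u ++ v).
Proof. by apply/eqP/pres_piP/pres_eq_cat; apply: pres_repr. Qed.

Lemma pres_invE u :
  pres_inv (\pi_presented u) = \pi_presented (word_inv u).
Proof. exact/eqP/pres_piP/pres_eq_inv/pres_repr. Qed.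

Fact pres_mulA : associative pres_mul.
Proof.
elim/quotW=> u; elim/quotW=> v; elim/quotW=> w.
by rewrite (pres_mulE v w) (pres_mulE u v) (pres_mulE u) (pres_mulE _ w) catA.
Qed.

Fact pres_mul1 : left_id pres_one pres_mul.
Proof. by elim/quotW=> u; rewrite pres_mulE. Qed.

Fact pres_mulr1 : right_id pres_one pres_mul.
Proof. by elim/quotW=> u; rewrite pres_mulE cats0. Qed.

Fact pres_mulV : left_inverse pres_one pres_inv pres_mul.
Proof.
elim/quotW=> u; rewrite pres_invE pres_mulE.
exact/eqP/pres_piP/word_catVl.
Qed.

Fact pres_mulrV : right_inverse pres_one pres_inv pres_mul.
Proof.
elim/quotW=> u; rewrite pres_invE pres_mulE.
exact/eqP/pres_piP/word_catV.
Qed.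

HB.instance Definition _ := isGroup.Build presented
  pres_mulA pres_mul1 pres_mulr1 pres_mulV pres_mulrV.

End Presentation.

Section Subgroups.
Variable G : groupType.

Definition subgroup (H : set G) : Prop :=
  [/\ H 1, forall x y, H x -> H y -> H (x * y) & forall x, H x -> H x^-1].

Definition gen_subgroup (S : set G) : set G := smallest subgroup S.

Definition commutator_subgroup (A B : set G) : set G :=
  gen_subgroup [set z | exists2 a, A a & exists2 b, B b & z = [~ a, b]]%classic.

(* gamma_n(G), with gamma_1(G) = G; gamma_0(G) = G by convention. *)
Definition lower_central (n : nat) : set G :=
  iter n.-1 (fun A => commutator_subgroup A setT) setT.

Record normal_subgroup := NormalSubgroup {
  nsg_set : set G;
  nsg_subgroup : subgroup nsg_set;
  nsg_conj : forall x g, nsg_set x -> nsg_set (x ^ g)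
}.

Lemma gen_subgroupP (S : set G) : subgroup (gen_subgroup S).
Proof.
split=> [H [[]] // | x y Hx Hy H HS | x Hx H HS].
- by have [[_ HM _] _] := HS; apply: HM; [apply: Hx | apply: Hy].
- by have [[_ _ HV] _] := HS; apply: HV; apply: Hx.
Qed.

Lemma gen_subgroup_conj (S : set G) :
  (forall x g, S x -> S (x ^ g)) ->
  forall x g, gen_subgroup S x -> gen_subgroup S (x ^ g).
Proof.
move=> SJ x g; move: x.
apply: (@smallest_sub _ subgroup S (fun x => gen_subgroup S (x ^ g))).
  have [S1 SM SV] := gen_subgroupP S.
  split=> [|x y Sx Sy|x Sx]; rewrite ?conj1g ?conjMg ?conjVg //.
  - exact: SM.
  - exact: SV.
by move=> x Sx; apply: sub_gen_smallest; apply: SJ.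
Qed.

Lemma lower_central_subgroup n : subgroup (lower_central n).
Proof. by case: n => [|[|n]] //; apply: gen_subgroupP. Qed.

Lemma lower_central_conj n x g :
  lower_central n x -> lower_central n (x ^ g).
Proof.
case: n => // n; elim: n => // n IHn in x g *.
apply: gen_subgroup_conj => _ h [a An [b _ ->]].
by exists (a ^ h); [apply: IHn | exists (b ^ h); rewrite ?conjRg].
Qed.

Definition gamma (n : nat) : normal_subgroup :=
  NormalSubgroup (lower_central_subgroup n) (@lower_central_conj n).

End Subgroups.

Section Quotient.
Variables (G : groupType) (N : normal_subgroup G).

Definition coset_eqb : rel G := fun x y => `[< nsg_set N (x^-1 * y) >].

Fact coset_eqb_refl : reflexive coset_eqb.
Proof. by move=> x; apply/asboolP; rewrite mulVg; have [] := nsg_subgroup N. Qed.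

Fact coset_eqb_sym : symmetric coset_eqb.
Proof.
have [_ _ NV] := nsg_subgroup N.
by move=> x y; apply/asboolP/asboolP => /NV; rewrite invgM invgK.
Qed.

Fact coset_eqb_trans : transitive coset_eqb.
Proof.
have [_ NM _] := nsg_subgroup N.
move=> y x z /asboolP xy /asboolP yz; apply/asboolP.
by rewrite -(mulKVg y z) mulgA; apply: NM.
Qed.

Canonical coset_equiv :=
  EquivRel coset_eqb coset_eqb_refl coset_eqb_sym coset_eqb_trans.

(* The quotient group G / N, its elements being the cosets x N. *)
Definition nquotient := {eq_quot coset_eqb}.
HB.instance Definition _ : EqQuotient _ coset_eqb nquotient :=
  EqQuotient.on nquotient.
HB.instance Definition _ := Choice.on nquotient.

Lemma nquotient_piP x y :
  reflect (nsg_set N (x^-1 * y)) (\pi_nquotient x == \pi_nquotient y).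
Proof. by rewrite eqmodE; apply: asboolP. Qed.

Lemma nquotient_repr x : nsg_set N ((repr (\pi_nquotient x))^-1 * x).
Proof. by apply/nquotient_piP; rewrite reprK. Qed.

Definition nquotient_one : nquotient := \pi_nquotient 1.
Definition nquotient_mul (a b : nquotient) : nquotient :=
  \pi_nquotient (repr a * repr b).
Definition nquotient_inv (a : nquotient) : nquotient :=
  \pi_nquotient (repr a)^-1.

Lemma nquotient_mulE x y :
  nquotient_mul (\pi_nquotient x) (\pi_nquotient y)
  = \pi_nquotient (x * y).
Proof.
have [_ NM _] := nsg_subgroup N.
apply/eqP/nquotient_piP; move: (nquotient_repr x) (nquotient_repr y).
set x' := repr _; set y' := repr _ => Nx Ny.
have -> : (x' * y')^-1 * (x * y) = (x'^-1 * x) ^ y' * (y'^-1 * y).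
  by rewrite invgM conjgE !mulgA mulgK.
by apply: NM => //; apply: nsg_conj.
Qed.

Lemma nquotient_invE x :
  nquotient_inv (\pi_nquotient x) = \pi_nquotient x^-1.
Proof.
have [_ _ NV] := nsg_subgroup N.
apply/eqP/nquotient_piP; move: (nquotient_repr x); set x' := repr _ => Nx.
have -> : x'^-1^-1 * x^-1 = ((x'^-1 * x)^-1) ^ x'^-1.
  by rewrite invgM conjgE !mulgA mulgVK.
by apply: nsg_conj; apply: NV.
Qed.

Fact nquotient_mulA : associative nquotient_mul.
Proof.
elim/quotW=> x; elim/quotW=> y; elim/quotW=> z.
by rewrite (nquotient_mulE y z) (nquotient_mulE x y) (nquotient_mulE x)
  (nquotient_mulE _ z) mulgA.
Qed.

Fact nquotient_mul1 : left_id nquotient_one nquotient_mul.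
Proof. by elim/quotW=> x; rewrite nquotient_mulE mul1g. Qed.

Fact nquotient_mulr1 : right_id nquotient_one nquotient_mul.
Proof. by elim/quotW=> x; rewrite nquotient_mulE mulg1. Qed.

Fact nquotient_mulV : left_inverse nquotient_one nquotient_inv nquotient_mul.
Proof. by elim/quotW=> x; rewrite nquotient_invE nquotient_mulE mulVg. Qed.

Fact nquotient_mulrV : right_inverse nquotient_one nquotient_inv nquotient_mul.
Proof. by elim/quotW=> x; rewrite nquotient_invE nquotient_mulE mulgV. Qed.

HB.instance Definition _ := isGroup.Build nquotient
  nquotient_mulA nquotient_mul1 nquotient_mulr1 nquotient_mulV nquotient_mulrV.

End Quotient.

Section Beauville.
Variable gT : finGroupType.
Implicit Types (G : {group gT}) (x y : gT).

Definition two_generator G : Prop := exists x y, <<[set x; y]>> = G.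

Definition Sigma G x y : {set gT} :=
  \bigcup_(g in G) (<[x]> :^ g :|: <[y]> :^ g :|: <[x * y]> :^ g).

Definition beauville_structure G x1 y1 x2 y2 : Prop :=
  [/\ <<[set x1; y1]>> = G, <<[set x2; y2]>> = G
    & Sigma G x1 y1 :&: Sigma G x2 y2 = 1].

Definition beauville_group G : Prop :=
  two_generator G /\ exists x1 y1 x2 y2, beauville_structure G x1 y1 x2 y2.

Definition strongly_real_beauville_group G : Prop :=
  beauville_group G /\
  exists x1 y1 x2 y2, beauville_structure G x1 y1 x2 y2 /\
    exists theta g1 g2,
      [/\ theta \in Aut G, g1 \in G, g2 \in G,
          g1 * theta x1 * g1^-1 = x1^-1 /\ g1 * theta y1 * g1^-1 = y1^-1
        & g2 * theta x2 * g2^-1 = x2^-1 /\ g2 * theta y2 * g2^-1 = y2^-1].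

End Beauville.

Definition isomorphic_groups (G H : groupType) : Prop :=
  exists f : {multiplicative G -> H}, bijective f.

(* < x, y | x^p, y^p >, with x and y the two elements of 'I_2. *)
Definition free_prod_Zp (p : nat) : groupType :=
  @presented 'I_2 (range (fun a : 'I_2 => nseq p (a, true)))%classic.

(* Main.v *)
(* Let G = F / gamma_{i+1}(F). The two generating pairs are (x, y) and (x2, y2)
   with x2 = y x y^-2 x y and y2 = x y^-1 x^-2 y^-1 x. These are palindromes, so
   the automorphism x |-> x^-1, y |-> y^-1 inverts all four elements.

   Since x^p = y^p = 1, a Hall-Petrescu argument shows that p-th powers of
   elements of gamma_n lie in gamma_{n+p-1}, so G has exponent dividing p^(k+1).
   The p-group of maximal class Z[zeta] / (zeta - 1)^i : C_p is a quotient of G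
   in which xy becomes a translation of order p^(k+1), so <xy> embeds, whereas
   elements outside <xy> Phi(G) map to elements of order p. This separates <xy>
   from the conjugates of <x2>, <y2> and <x2 y2>. For x and x2 (and likewise for
   y and y2) one uses the quotient F_p[t] / t^3 : C_p, where x maps to 1 and x2
   to T + T^-1 with T = 1 + t. The remaining pairs are separated in G / Phi(G).
   *)

Require Import Defs.
From HB Require Import structures.
From mathcomp Require Import all_boot all_order all_fingroup.
From mathcomp Require Import all_algebra all_solvable.

Set Implicit Arguments.
Unset Strict Implicit.
Unset Printing Implicit Defensive.

Import GRing.Theory.

(** * Commutator identities and closure properties of subgroups *)

Section GroupIdentities.
Local Open Scope group_scope.
Variable G : groupType.
Implicit Types x y z : G.

Let gsimp := (@mulgA G, @mulg1 G, @mul1g G, @mulgK G, @mulgVK G, @mulgV G,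
  @mulVg G, @invgM G, @invgK G, @invg1 G).

Lemma commgMr x y z : [~ x, y * z] = [~ x, z] * [~ x, y] ^ z.
Proof. by rewrite !commgEl !conjgE !gsimp. Qed.

Lemma commgMl x y z : [~ x * y, z] = [~ x, z] ^ y * [~ y, z].
Proof. by rewrite !commgEl !conjgE !gsimp. Qed.

Lemma commgVr x y : [~ x, y^-1] = [~ x, y]^-1 ^ y^-1.
Proof. by rewrite !commgEl !conjgE !gsimp. Qed.

Lemma hall_witt x y z :
  [~ x, y^-1, z] ^ y * [~ y, z^-1, x] ^ z * [~ z, x^-1, y] ^ x = 1.
Proof. by rewrite !commgEl !conjgE !gsimp. Qed.

End GroupIdentities.

Section Subgroup.
Local Open Scope group_scope.
Variables (G : groupType) (H : G -> Prop).
Hypothesis sH : subgroup H.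

Lemma subgroup1 : H 1.
Proof. by case: sH. Qed.

Lemma subgroupM x y : H x -> H y -> H (x * y).
Proof. by case: sH => _ HM _; apply: HM. Qed.

Lemma subgroupV x : H x -> H x^-1.
Proof. by case: sH => _ _; apply. Qed.

Lemma subgroupX x n : H x -> H (x ^+ n).
Proof.
move=> Hx; elim: n => [|n IHn]; first exact: subgroup1.
by rewrite expgS; apply: subgroupM.
Qed.

End Subgroup.

(** * The lower central series *)

Section LowerCentral.
Local Open Scope group_scope.
Variable G : groupType.
Implicit Types (x y a b g : G) (m n i j : nat).
Local Notation L := (@lower_central G).

Lemma gen_subgroup_ind (S P : G -> Prop) :
  subgroup P -> (forall x, S x -> P x) -> forall x, gen_subgroup S x -> P x.
Proof. by move=> sP SP x; apply; split. Qed.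

Lemma lower_central1 n : L n 1.
Proof. exact: (@subgroup1 _ (L n) (lower_central_subgroup G n)). Qed.

Lemma lower_centralM n x y : L n x -> L n y -> L n (x * y).
Proof. exact: (@subgroupM _ (L n) (lower_central_subgroup G n)). Qed.

Lemma lower_centralV n x : L n x -> L n x^-1.
Proof. exact: (@subgroupV _ (L n) (lower_central_subgroup G n)). Qed.

Lemma lower_centralX n m x : L n x -> L n (x ^+ m).
Proof. exact: (@subgroupX _ (L n) (lower_central_subgroup G n) x m). Qed.

Lemma lower_central_comm n a g : L n a -> L n.+1 [~ a, g].
Proof.
case: n => // n La H [sH]; apply.
by exists a => //; exists g.
Qed.

Lemma lower_central_ind n (P : G -> Prop) :
  subgroup P -> (forall a g, L n.+1 a -> P [~ a, g]) ->
  forall x, L n.+2 x -> P x.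
Proof.
move=> sP PR; apply: gen_subgroup_ind => // _ [a La [g _ ->]].
exact: PR.
Qed.

Lemma lower_centralS n x : L n.+1 x -> L n x.
Proof.
case: n => // n; move: x.
apply: lower_central_ind => [|a g La]; first exact: lower_central_subgroup.
rewrite commgEl; apply: lower_centralM; first exact: lower_centralV.
exact: lower_central_conj.
Qed.

Lemma lower_central_le m n x : (m <= n)%N -> L n x -> L m x.
Proof. by move=> /subnK <-; elim: (n - m)%N => // d IH /lower_centralS. Qed.

Lemma lower_central_commg i j a b : L i a -> L j b -> L (i + j) [~ a, b].
Proof.
have nL := @lower_central_conj G.
(* Since [lower_central] at 0 is all of G, the claim for i = 0 is only that [a, b] stays in
   gamma_j. *)
case: i => [|i] La.
  move/lower_central_comm/lower_centralS => Lb.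
  by rewrite -invgR; apply: lower_centralV (Lb a).
case: j => [_|j].
  by rewrite addn0; apply/lower_centralS/lower_central_comm.
elim: j => [|j IHj] in i a b La * => [_|].
  by rewrite addn1; apply: lower_central_comm.
move: b; apply: lower_central_ind => [|b g Lb].
  split=> [|b c Lb Lc|b Lb].
  - by rewrite commg1; apply: lower_central1.
  - by rewrite commgMr; apply: lower_centralM => //; apply: (nL).
  - by rewrite commgVr; apply: (nL); apply: lower_centralV.
rewrite -invgR; apply: lower_centralV => //.
(* Three subgroups argument: Hall-Witt expresses [b, g, a] through [a, b^-1, g^-1] and
   [g^-1, a^-1, b], both covered by the induction on j. *)
have /(canRL (mulgK _)) := hall_witt a b g^-1; rewrite mul1g invgK => HW.
have -> : [~ b, g, a] =
    (([~ a, b^-1, g^-1] ^ b)^-1 * ([~ g^-1, a^-1, b] ^ a)^-1) ^ g.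
  by rewrite -HW mulKg conjgKV.
apply: (nL); apply: lower_centralM => //; apply: lower_centralV => //;
  apply: (nL).
  rewrite addnS; apply: lower_central_comm; apply: IHj => //.
  exact: lower_centralV.
rewrite addnS -addSn; apply: IHj => //; rewrite -invgR;
  apply: lower_centralV => //.
by apply: lower_central_comm; apply: lower_centralV.
Qed.

End LowerCentral.

(** * Polynomial sequences and the exponent of a nilpotent group *)

Section PolynomialSequences.
Local Open Scope group_scope.
Variable G : groupType.
Implicit Types (f g : nat -> G) (d e m n : nat).
Local Notation L := (@lower_central G).

(* Polynomial sequences in the sense of Lazard and Leibman: the first n discrete
   derivatives of f lie in gamma_d, gamma_{d+1}, and so on. Truncating at order
   n makes the closure properties provable by induction on n. *)
Fixpoint poly_seq n d f : Prop :=
  (forall m, L d (f m)) /\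
  if n is n'.+1 then poly_seq n' d.+1 (fun m => (f m)^-1 * f m.+1) else True.

Lemma poly_seq_ext n d f g : f =1 g -> poly_seq n d f -> poly_seq n d g.
Proof.
elim: n => [|n IHn] in d f g * => fg /= [Lf Pf];
  (split; first by move=> m; rewrite -fg); first by [].
by apply: IHn Pf => m /=; rewrite !fg.
Qed.

Lemma poly_seqW n d f : poly_seq n.+1 d f -> poly_seq n d f.
Proof.
elim: n => [|n IHn] in d f *; first by case.
by move=> [Lf] /IHn.
Qed.

Lemma poly_seq_le n d e f : (d <= e)%N -> poly_seq n e f -> poly_seq n d f.
Proof.
elim: n => [|n IHn] in d e f * => de [Lf Pf];
  (split; first by move=> m; apply: lower_central_le (Lf m)); first by [].
by apply: IHn Pf; rewrite ltnS.
Qed.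

(** The three closure properties need one another and are proved by a common induction on n. With F
    and H the derivatives of f and g, the derivative of f g is F^g H, and conjugation reduces to u^g
    = u [u, g]. *)
Lemma poly_seq_group n :
  [/\ forall d f g, poly_seq n d f -> poly_seq n d g ->
        poly_seq n d (fun m => f m * g m),
      forall d f, poly_seq n d f -> poly_seq n d (fun m => (f m)^-1)
    & forall d e f g, poly_seq n d f -> poly_seq n e g ->
        poly_seq n (d + e) (fun m => [~ f m, g m])].
Proof.
elim: n => [|n [PM PV PR]].
  split=> [d f g [Lf _] [Lg _]|d f [Lf _]|d e f g [Lf _] [Lg _]]; split=> // m.
  - exact: lower_centralM.
  - exact: lower_centralV.
  - exact: lower_central_commg.
have PJ d e f g : poly_seq n d f -> poly_seq n e g ->
    poly_seq n d (fun m => f m ^ g m).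
  move=> Pf Pg.
  apply: (@poly_seq_ext _ _ (fun m => f m * [~ f m, g m])) => [m|].
    by rewrite commgEl mulVKg.
  by apply: (PM) => //; apply: poly_seq_le (PR _ _ _ _ Pf Pg); apply: leq_addr.
split=> [d f g|d f|d e f g].
- move=> Pf Pg; have [[Lf Df] [Lg Dg]] := (Pf, Pg).
  split=> [m|]; first exact: lower_centralM.
  apply: poly_seq_ext (PM _ _ _ (PJ _ _ _ _ Df (poly_seqW Pg)) Dg) => m /=.
  by rewrite conjgE invgM !mulgA mulgK.
- move=> Pf; have [Lf Df] := Pf.
  split=> [m|]; first exact: lower_centralV.
  apply: poly_seq_ext (PJ _ _ _ _ (PV _ _ Df) (PV _ _ (poly_seqW Pf))) => m /=.
  by rewrite conjgE !invgM !invgK !mulgA mulgK.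
move=> Pf Pg; have [[Lf Df] [Lg Dg]] := (Pf, Pg).
split=> [m|]; first exact: lower_central_commg.
move/poly_seqW in Pf; move/poly_seqW in Pg; have Pw := PR _ _ _ _ Pf Pg.
set F := fun m => _ in Df; set H := fun m => _ in Dg.
have PfH := PR _ _ _ _ Pf Dg; have PFH := PR _ _ _ _ Df Dg.
have PFg := PR _ _ _ _ Df Pg.
have PHF : poly_seq n 1 (fun m => H m * F m).
  by apply: (PM); [apply: poly_seq_le Dg | apply: poly_seq_le Df].
have PwHF := PR _ _ _ _ Pw PHF; rewrite addn1 in PwHF.
rewrite addSn in PFg; rewrite addnS in PfH.
rewrite addSn in PFH.
have {}PFH : poly_seq n (d + e).+1 (fun m => [~ F m, H m]).
  by apply: poly_seq_le PFH; rewrite ltnS addnS.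
(* The derivative of w = [f, g] is the product of [f, H]^(F w), [w, H F], [F, H] and [F, g]^H, all
   of level at least d + e + 1. *)
have := PM _ _ _ (PM _ _ _ (PM _ _ _ (PJ _ _ _ _ (PJ _ _ _ _ PfH Df) Pw) PwHF)
  PFH) (PJ _ _ _ _ PFg Dg).
apply: poly_seq_ext => m /=.
have -> : f m.+1 = f m * F m by rewrite /F mulVKg.
have -> : g m.+1 = g m * H m by rewrite /H mulVKg.
rewrite [in RHS]commgMl (commgMr (f m)) (commgMr (F m)).
by rewrite !commgEl !conjgE !(@mulgA G, @mulgK G, @mulgVK G, @invgM G,
  @invgK G).
Qed.

(** By Pascal's rule the derivative of m |-> a^'C(m, j+1) is m |-> a^'C(m, j), so each derivative
    trades one unit of j for one of d. *)
Lemma poly_seq_binom n d j a :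
  L (d + j) a -> poly_seq n d (fun m => a ^+ 'C(m, j)).
Proof.
have LX i k : L (i + k) a -> forall m, L i (a ^+ m).
  move=> La m; apply: lower_centralX => //;
    exact: lower_central_le (leq_addr _ _) La.
elim: n => [|n IHn] in d j *; first by move=> La; split=> // m; apply: LX La _.
move=> La; split=> [m|]; first exact: LX La _.
case: j => [|j] in La *.
  apply: (@poly_seq_ext _ _ (fun=> 1)) => [m|]; first by rewrite !bin0 mulVg.
  elim: {IHn} n (d.+1) => [|n IHn] e; (split=> [m|//];
    first exact: lower_central1).
  apply: poly_seq_ext (IHn _) => m; by rewrite invg1 mulg1.
apply: (@poly_seq_ext _ _ (fun m => a ^+ 'C(m, j))) => [m|].
  by rewrite binS expgnDr mulKg.
by apply: IHn; rewrite addSnnS.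
Qed.

(** If f is 1 below j, its derivative is 1 below j - 1 and equals f j there; after j derivatives f j
    is a value at level d + j. *)
Lemma poly_seq_vanish n d j f :
  (j <= n)%N -> poly_seq n d f -> (forall l, (l < j)%N -> f l = 1) ->
    L (d + j) (f j).
Proof.
elim: j => [|j IHj] in n d f *; first by case: n => [|n] _ [Lf _];
  rewrite addn0.
case: n => // n jn [_ Pf] f1; have /= := IHj _ _ _ jn Pf.
rewrite (f1 j) // invg1 mul1g addSnnS; apply=> l lj.
by rewrite !f1 ?invg1 ?mulg1 // ltnW.
Qed.

(* By successively splitting off factors m |-> a_j^'C(m, j) with a_j in
   gamma_{d+j}, f p is the product of the a_j^'C(p, j) for 1 <= j <= p, where
   a_1 = f 1 and p divides 'C(p, j) for 1 < j < p. *)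
Lemma poly_seq_prime p M n d f : prime p -> (p <= n)%N -> (M <= d + p)%N ->
  (forall l a, (1 < l < p)%N -> L (d + l) a -> L M (a ^+ p)) ->
  poly_seq n d f -> f 0%N = 1 -> L M (f 1%N ^- p * f p).
Proof.
move=> p_pr pn Mp LX; have [PM PV _] := poly_seq_group n.
have p_gt1 := prime_gt1 p_pr.
have quot j g :
    (j <= p)%N -> poly_seq n d g -> (forall l, (l < j)%N -> g l = 1) ->
  exists2 h, poly_seq n d h & (forall l, (l < j.+1)%N -> h l = 1) /\
    forall m, h m = g j ^- 'C(m, j) * g m.
  move=> jp Pg g1; exists (fun m => g j ^- 'C(m, j) * g m); last first.
    split=> // l; rewrite ltnS leq_eqVlt => /predU1P[->|lj];
      first by rewrite binn mulVg.
    by rewrite bin_small // expg0 g1 // invg1 mulg1.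
  apply: (PM) => //; apply: (PV); apply: poly_seq_binom.
  by apply: poly_seq_vanish Pg g1; apply: leq_trans pn.
have tail j g : (1 < j <= p)%N -> poly_seq n d g ->
    (forall l, (l < j)%N -> g l = 1) -> L M (g p).
  move=> /andP[j1 /subnK]; move: (p - j)%N => k.
  elim: k j g j1 => [|k IHk] j g j1; last first.
    rewrite addSnnS => jp Pg g1.
    have jltp : (j < p)%N by rewrite -jp addnS ltnS leq_addl.
    have [h Ph [h1 Eh]] := quot j g (ltnW jltp) Pg g1.
    have /(prime_dvd_bin p_pr)/dvdnP[b Eb] : (0 < j < p)%N by rewrite jltp ltnW.
    have Lgj := poly_seq_vanish (leq_trans (ltnW jltp) pn) Pg g1.
    have := IHk _ _ (leqW j1) jp Ph h1; rewrite Eh.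
    rewrite Eb => LMh.
    rewrite -[g p](mulVKg (g j ^+ (b * p)%N)); apply: lower_centralM => //.
    rewrite expgnA; apply: LX (_ : (1 < j < p)%N) _; first by rewrite j1.
    exact: lower_centralX.
  rewrite add0n => -> Pg g1; apply: lower_central_le Mp _.
  exact: poly_seq_vanish pn Pg g1.
move=> Pf f0.
have [|h Ph [h1 Eh]] := quot 1%N f (ltnW p_gt1) Pf; first by case.
by rewrite -{1}[p]bin1 -Eh; apply: tail Ph h1.
Qed.

End PolynomialSequences.

(** * Powers of p in the lower central series *)

Section Exponent.
Local Open Scope group_scope.
Variables (G : groupType) (p : nat) (X : G -> Prop).
Hypotheses (p_pr : prime p)
  (genX : forall H, subgroup H -> (forall x, X x -> H x) -> forall g, H g)
  (X_p : forall x, X x -> x ^+ p = 1).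
Local Notation L := (@lower_central G).

(* The sequences u^m v^m and [a, x^m], the latter with value 1 at m = p, show
   that the p-th power map is multiplicative on gamma_n and kills its generators
   modulo gamma_{n+p-1}. *)
Lemma lower_central_expg c n a : (forall g, L c.+1 g -> g = 1) ->
  (0 < n)%N -> L n a -> L (n + p.-1) (a ^+ p).
Proof.
move=> nilG; have nL := @lower_central_conj G.
have p_gt0 := prime_gt0 p_pr.
(* Descending induction on n, which starts at n > c, where gamma_n is trivial. *)
have [m] := ubnP (c.+1 - n)%N; elim: m => // m IHm in n a * => nm n0.
have [cn|nc] := leqP c.+1 n.
  by move/(lower_central_le cn)/nilG->; rewrite expg1n; apply: lower_central1.
have {m IHm nm} IH k b : (n < k)%N -> L k b -> L (k + p.-1) (b ^+ p).
  move=> nk; apply: IHm; last exact: leq_trans nk.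
  by rewrite -ltnS; apply: leq_trans nm; rewrite ltnS; apply: ltn_sub2l.
move: a; case: n => // n in n0 nc IH *.
have [PM PV PR] := poly_seq_group G p.
have LX f : @poly_seq G p n f -> f 0%N = 1 ->
  L (n.+1 + p.-1) (f 1%N ^- p * f p).
  apply: poly_seq_prime => //; first by rewrite addSnnS prednK.
  move=> l a /andP[l1 lp] La.
  have nl : (n.+1 < n + l)%N by rewrite -addn2 leq_add2l.
  by apply: lower_central_le (IH _ _ nl La); rewrite leq_add2r ltnW.
have PX k u : L k.+1 u -> @poly_seq G p k (fun m => u ^+ m).
  move=> Lu; apply: poly_seq_ext (poly_seq_binom (j := 1) _ _) => [m|];
    first by rewrite bin1.
  by rewrite addn1.
pose Q a := L n.+1 a /\ L (n.+1 + p.-1) (a ^+ p).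
have sQ : subgroup Q.
  split=> [|u v [Lu Qu] [Lv Qv]|u [Lu Qu]]; rewrite /Q.
  - by rewrite expg1n; split; apply: lower_central1.
  - split; first exact: lower_centralM.
    have /= := LX _ (PM _ _ _ (PX _ _ Lu) (PX _ _ Lv)) (mulg1 _).
    rewrite !expg1 => /lower_centralM/(_ (lower_centralV (lower_centralM Qu
      Qv))).
    by rewrite mulgK => /lower_centralV; rewrite invgK.
  - by rewrite expVgn; split; apply: lower_centralV.
have nQ u g : Q u -> Q (u ^ g).
  by move=> [Lu Qu]; split; [apply: (nL) | rewrite -conjXg; apply: (nL)].
suff: forall a, L n.+1 a -> Q a by move=> QL a /QL[].
case: n => [|n] in nc n0 IH LX PX Q sQ nQ *.
  move=> a _; move: a; apply: genX => // x Xx; split=> //.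
  by rewrite X_p //; apply: lower_central1.
apply: lower_central_ind => // a g; move: g a.
apply: genX => [|x Xx a La].
  split=> [a La|g h Qg Qh a La|g Qg a La].
  - by rewrite commg1; apply: subgroup1.
  - by rewrite commgMr; apply: subgroupM => //; [apply: Qh | apply: (nQ);
    apply: Qg].
  - by rewrite commgVr; apply: (nQ); apply: subgroupV => //; apply: Qg.
split; first exact: lower_central_comm.
have Pa : @poly_seq G p n.+1 (fun=> a).
  apply: poly_seq_ext (poly_seq_binom (j := 0) (a := a) _ _) => [m|];
    first by rewrite bin0.
  by rewrite addn0.
have Px := PX 0%N x I.
have := LX (fun m => [~ a, x ^+ m]); rewrite /= (X_p Xx) expg0 expg1 !commg1
  mulg1 => LXa.
have := PR _ _ _ _ Pa Px; rewrite addn0 => /LXa/(_ erefl)/lower_centralV.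
by rewrite invgK.
Qed.

(** Each p-th power descends p - 1 steps, so k of them lead from gamma_1 to gamma_{k(p-1)+1}, which
    is trivial. *)
Lemma expg_nilpotent c k (g : G) : (forall g, L c.+1 g -> g = 1) ->
  (c <= k * p.-1)%N -> g ^+ (p ^ k) = 1.
Proof.
move=> nilG ck; apply: (nilG); apply: (@lower_central_le _ _ (k * p.-1).+1);
  first by rewrite ltnS.
elim: k {ck} => [|k IHk]; first by [].
rewrite expnSr expgnA mulSn addnC -addSn.
exact: (@lower_central_expg c).
Qed.

End Exponent.

(** * The quotient of F by a term of its lower central series *)

Section Homomorphisms.
Local Open Scope group_scope.
Variables (G H : groupType) (f : G -> H).
Hypothesis fM : {morph f : x y / x * y}.

Lemma homo1g : f 1 = 1.
Proof. by apply: (@mulgI _ (f 1)); rewrite -fM !mulg1. Qed.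

Lemma homoVg : {morph f : x / x^-1}.
Proof. by move=> x; apply: (@mulgI _ (f x)); rewrite -fM !mulgV homo1g. Qed.

Lemma homoXg n : {morph f : x / x ^+ n}.
Proof.
by move=> x; elim: n => [|n IHn]; rewrite ?expg0 ?homo1g // !expgS fM IHn.
Qed.

Lemma homoJg : {morph f : x y / x ^ y}.
Proof. by move=> x y; rewrite !conjgE !fM homoVg. Qed.

Lemma homoRg : {morph f : x y / [~ x, y]}.
Proof. by move=> x y; rewrite !commgEl fM homoVg homoJg. Qed.

Lemma subgroup_preim (P : H -> Prop) :
  subgroup P -> subgroup (fun x => P (f x)).
Proof.
move=> sP; split=> [|x y Px Py|x Px].
- by rewrite homo1g; apply: subgroup1.
- by rewrite fM; apply: subgroupM.
- by rewrite homoVg; apply: subgroupV.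
Qed.

(** D is indexed from 0, so D n receives gamma_{n+1}; its centrality is asked against the image of f
    only. *)
Lemma lower_central_homo (D : nat -> H -> Prop) :
    (forall n, subgroup (D n)) -> (forall x, D 0%N (f x)) ->
    (forall n a x, D n a -> D n.+1 [~ a, f x]) ->
  forall n x, lower_central n.+1 x -> D n (f x).
Proof.
move=> sD D0 DR; elim=> [|n IHn] //.
apply: lower_central_ind => [|a g La]; first exact: subgroup_preim.
by rewrite homoRg; apply/DR/IHn.
Qed.

Lemma lower_central_surj n y : (forall y, exists x, f x = y) ->
  lower_central n y -> exists2 x, lower_central n x & f x = y.
Proof.
move=> f_surj; case: n => [|n].
  by move=> _; have [x <-] := f_surj y; exists x.
elim: n y => [|n IHn] y; first by move=> _; have [x <-] := f_surj y; exists x.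
move: y; apply: lower_central_ind => [|a g].
  split=> [|y z [x Lx <-] [x' Lx' <-]|y [x Lx <-]].
  - by exists 1; [apply: lower_central1 | apply: homo1g].
  - by exists (x * x'); [apply: lower_centralM | apply: fM].
  - by exists x^-1; [apply: lower_centralV | apply: homoVg].
move=> /IHn[x Lx <-]; have [h <-] := f_surj g.
by exists [~ x, h]; [apply: lower_central_comm | apply: homoRg].
Qed.

End Homomorphisms.

Section QuotientMap.
Local Open Scope group_scope.
Local Open Scope quotient_scope.
Variables (G : groupType) (N : normal_subgroup G).

Definition nquotient_map (x : G) : nquotient N := \pi_(nquotient N) x.

Lemma nquotient_mapM : {morph nquotient_map : x y / x * y}.
Proof. by move=> x y; rewrite /nquotient_map -nquotient_mulE. Qed.

Lemma nquotient_map_surj y : exists x, nquotient_map x = y.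
Proof. by exists (generic_quotient.repr y); rewrite /nquotient_map reprK. Qed.

Lemma nquotient_mapP x y :
  reflect (nsg_set N (x^-1 * y)) (nquotient_map x == nquotient_map y).
Proof. exact: nquotient_piP. Qed.

Lemma nquotient_map_eq1 x : nsg_set N x -> nquotient_map x = 1.
Proof.
move=> Nx; rewrite -(homo1g nquotient_mapM); apply/esym/eqP/nquotient_mapP.
by rewrite invg1 mul1g.
Qed.

Lemma nquotient_lift (H : groupType) (f : G -> H) :
    {morph f : x y / x * y} -> (forall x, nsg_set N x -> f x = 1) ->
  exists2 g : nquotient N -> H, {morph g : x y / x * y}
    & forall x, g (nquotient_map x) = f x.
Proof.
move=> fM fN; pose g (q : nquotient N) := f (generic_quotient.repr q).
have gE x : g (nquotient_map x) = f x.
  have := nquotient_repr N x; rewrite /g => /fN; rewrite fM (homoVg fM) =>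
    /(congr1 (mulg (f (generic_quotient.repr (nquotient_map x))))).
  by rewrite mulVKg mulg1 => <-.
exists g => // q r; have [x <-] := nquotient_map_surj q.
have [y <-] := nquotient_map_surj r.
by rewrite -nquotient_mapM !gE fM.
Qed.

End QuotientMap.

(** * Homomorphisms out of a presented group *)

Section PresentedLift.
Local Open Scope group_scope.
Local Open Scope quotient_scope.
Variables (X : choiceType) (R : seq (X * bool) -> Prop).

Definition word_class (u : seq (X * bool)) : presented R := \pi_(presented R) u.
Definition letter (x : X) := word_class [:: (x, true)].

Lemma word_class_cat u v : word_class (u ++ v) = word_class u * word_class v.
Proof. exact/esym/pres_mulE. Qed.

Lemma word_classV u : word_class (word_inv u) = (word_class u)^-1.
Proof. exact/esym/pres_invE. Qed.

Lemma word_class_surj g : exists u, g = word_class u.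
Proof. by exists (generic_quotient.repr g); rewrite /word_class reprK. Qed.

Lemma presented_gen (P : presented R -> Prop) :
  subgroup P -> (forall x, P (letter x)) -> forall g, P g.
Proof.
move=> sP PX g; have [u ->] := word_class_surj g.
elim: u => [|[x b] u IHu]; first exact: (subgroup1 sP).
rewrite -cat1s word_class_cat; apply: (subgroupM sP _ IHu).
by case: b; [apply: PX | have := subgroupV sP (PX x); rewrite -word_classV].
Qed.

Lemma letterX x n : letter x ^+ n = word_class (nseq n (x, true)).
Proof. by elim: n => // n IHn; rewrite expgS IHn -word_class_cat. Qed.

Lemma word_class_rel r : R r -> word_class r = 1.
Proof. by move=> Rr; apply/eqP/pres_piP/pres_eq_rel. Qed.

Variables (H : groupType) (f : X -> H).

Definition word_value (u : seq (X * bool)) : H :=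
  foldr (fun a h => (if a.2 then f a.1 else (f a.1)^-1) * h) 1 u.

Lemma word_value_cat u v : word_value (u ++ v) = word_value u * word_value v.
Proof. by elim: u => [|a u IHu] /=; rewrite ?mul1g // IHu mulgA. Qed.

Hypothesis fR : forall r, R r -> word_value r = 1.

Lemma word_value_eq u v : pres_eq R u v -> word_value u = word_value v.
Proof.
elim=> {u v}
  [//|u v _ -> //|v u w _ -> _ -> //|u u' v v' _ Eu _ Ev|x b|r /fR //].
  by rewrite !word_value_cat Eu Ev.
by case: b; rewrite /= mulg1 ?mulgV ?mulVg.
Qed.

Lemma presented_lift :
  exists2 g : presented R -> H, {morph g : x y / x * y}
    & forall x, g (letter x) = f x.
Proof.
pose g (a : presented R) := word_value (generic_quotient.repr a).
have gE u : g (word_class u) = word_value u by apply/word_value_eq/pres_repr.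
exists g => [a b|x]; last by rewrite gE /= mulg1.
by rewrite [LHS]gE word_value_cat.
Qed.

End PresentedLift.

(** * Finiteness of finitely generated nilpotent groups with torsion generators *)

Section ListedGroup.
Variables (E : groupType) (s : seq E).

(** An alias of E that carries the proof that s exhausts it, so that countable and finite structures
    can be attached. *)
Definition listed_group of (forall x, x \in s) : Type := E.
Hypothesis sE : forall x, x \in s.
Local Notation T := (listed_group sE).

HB.instance Definition _ := Group.on T.

Let unlist n : option T := nth None (map Some s) n.
Fact listed_pickleK : pcancel (fun x : T => index (x : E) s) unlist.
Proof.
move=> x; rewrite /unlist (nth_map (x : E)) ?index_mem;
  first by rewrite nth_index.
exact: sE.
Qed.
HB.instance Definition _ := isCountable.Build T listed_pickleK.
Fact listed_enumP : Finite.axiom (undup s : seq T).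
Proof. by move=> x; rewrite (count_uniq_mem _ (undup_uniq s)) mem_undup sE. Qed.
HB.instance Definition _ := isFinite.Build T listed_enumP.

Lemma listed_group_finite : exists gT : finGroupType, exists2 f : E -> gT,
  bijective f & {morph f : x y / (x * y)%g}.
Proof. by exists T, id => //; exists id. Qed.

End ListedGroup.

Section Finiteness.
Local Open Scope group_scope.

Lemma listed_generated (E : groupType) (S : E -> Prop) (l : seq E) r :
    (0 < r)%N -> (forall x, x \in l -> forall y, commute x y) ->
    (forall x, x \in l -> x ^+ r = 1) ->
    (forall x, S x -> x \in l) ->
  exists s : seq E, forall x, gen_subgroup S x -> x \in s.
Proof.
move=> r0 lC lr Sl.
suff [s [s1 sM sV ls]] : exists s : seq E, [/\ 1 \in s,
    forall x y, x \in s -> y \in s -> x * y \in s,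
    forall x, x \in s -> x^-1 \in s & {subset l <= s}].
  by exists s => x; apply: (gen_subgroup_ind (P := fun x => x \in s)) =>
    // y /Sl/ls.
elim: l => [|a l IHl] in lC lr {Sl} *.
  exists [:: 1]; split=> // [|x y|x]; rewrite !inE //.
    by move=> /eqP-> /eqP->; rewrite mulg1.
  by move=> /eqP->; rewrite invg1.
have [||s [s1 sM sV ls]] := IHl.
- by move=> x lx; apply: lC; rewrite inE lx orbT.
- by move=> x lx; apply: lr; rewrite inE lx orbT.
have ar : a ^+ r = 1 by apply: lr; rewrite mem_head.
have aC y n : commute (a ^+ n) y by
  apply/commute_sym/commuteX/commute_sym/lC/mem_head.
(* Since a is central with a^r = 1, the products a^e y with e < r and y in the list s for the tail
   are closed under the group operations. *)
pose t := [seq a ^+ e * y | e <- iota 0 r, y <- s].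
have tP e y : y \in s -> a ^+ e * y \in t.
  move=> sy; have -> : a ^+ e = a ^+ (e %% r).
    by rewrite {1}(divn_eq e r) expgnDr mulnC expgnA ar expg1n mul1g.
  by apply/allpairsP; exists (e %% r, y)%N; rewrite mem_iota ltn_mod.
exists t; split=> [|x y|x|x].
- by rewrite -[1]mulg1 -(expg0 a); apply: tP.
- move=> /allpairsP[[e u] /= [_ su ->]] /allpairsP[[e' v] /= [_ sv ->]].
  have -> : a ^+ e * u * (a ^+ e' * v) = a ^+ (e + e') * (u * v).
    by rewrite -!mulgA (mulgA u) -(aC u e') expgnDr !mulgA.
  by apply/tP/sM.
- move=> /allpairsP[[e u] /= [elt su ->]]; rewrite mem_iota in elt.
  have -> : (a ^+ e * u)^-1 = a ^+ (r - e) * u^-1.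
    rewrite expgnFr ?ar ?mul1g; last by apply: ltnW.
    by rewrite invgM; apply/esym/commute_sym/commuteV/commute_sym/commuteV;
      apply: aC.
  by apply/tP/sV.
- rewrite inE => /predU1P[->|/ls sx]; last by rewrite -[x]mul1g -(expg0 a);
  apply: tP.
  by rewrite -[a]mulg1 -[X in X * 1]expg1; apply: tP.
Qed.

(* The last nontrivial term is central, hence generated by commutators of coset
   representatives, of which there are finitely many, all of finite order. *)
Lemma nilpotent_listed (c : nat) (E : groupType) (x y : E) n :
    (0 < n)%N -> x ^+ n = 1 -> y ^+ n = 1 ->
    (forall P, subgroup P -> P x -> P y -> forall g, P g) ->
    (forall g : E, lower_central c.+1 g -> g = 1) ->
  exists s : seq E, forall g, g \in s.
Proof.
move=> n0; elim: c => [|[|c] IHc] in E x y * => xn yn genE nilE.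
- by exists [:: 1] => g; rewrite inE; apply/eqP/nilE.
(* Here the last nontrivial term can be gamma_1 itself, which is generated by x and y rather than by
   commutators. *)
- have EC (a b : E) : commute a b by apply/commgP/eqP/nilE/lower_central_comm.
  have [||||s gs] :=
    @listed_generated E (fun g => g = x \/ g = y) [:: x; y] n => //.
  + by move=> z; rewrite !inE => /orP[]/eqP->.
  + by move=> z [] ->; rewrite !inE eqxx ?orbT.
  exists s => g; apply: gs; move: g.
  by apply: genE => [|H [_]|H [_]]; [apply: gen_subgroupP | apply;
    left | apply; right].
set N := gamma E c.+2; pose f := nquotient_map N.
have fM : {morph f : a b / a * b} by apply: nquotient_mapM.
have f_surj := @nquotient_map_surj _ N.
have NP a b : f a = f b -> lower_central c.+2 (a^-1 * b) by
  move/eqP/nquotient_mapP.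
have [||||sQ sQP] := IHc (nquotient N) (f x) (f y).
- by rewrite -(homoXg fM) xn homo1g.
- by rewrite -(homoXg fM) yn homo1g.
- move=> P sP Px Py g; have [a <-] := f_surj g; apply: (genE (P \o f)) => //.
  exact: (subgroup_preim fM).
- by move=> g /(lower_central_surj fM f_surj)[a La <-];
  apply: nquotient_map_eq1.
have [gT [h h_bij hM]] := listed_group_finite sQP.
have expQ (a : E) : f (a ^+ #|gT|) = 1.
  apply: (bij_inj h_bij); rewrite (homo1g hM) (homoXg fM) (homoXg hM).
  by rewrite -cardsT expg_cardG ?inE.
pose T := [seq generic_quotient.repr q | q <- sQ].
have TP (a : E) : exists2 t, t \in T & lower_central c.+2 (t^-1 * a).
  exists (generic_quotient.repr (f a)); first by apply: map_f.
  by apply: NP; rewrite /f /nquotient_map reprK.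
have NZ (z a : E) : lower_central c.+2 z -> commute z a.
  by move=> Nz; apply/commgP/eqP/nilE/lower_central_comm.
have NJ (z a : E) : lower_central c.+2 z -> a ^ z = a.
  by move=> Nz; rewrite conjgE -(NZ z a Nz) mulKg.
have commNl (a b z : E) : lower_central c.+2 z -> [~ a * z, b] = [~ a, b].
  by move=> Nz; rewrite commgMl NJ // (eqP (introT commgP (NZ z b Nz))) mulg1.
have commNr (a b z : E) : lower_central c.+2 z -> [~ a, b * z] = [~ a, b].
  by move=> Nz; rewrite -invgR commNl // invgR.
pose S (z : E) := exists2 a, lower_central c.+1 a & exists2 b,
  classical_sets.setT b & z = [~ a, b].
pose l := [seq z <- [seq [~ t, t'] | t <- T, t' <- T] | boolp.asbool (S z)].
have lN z : z \in l -> lower_central c.+2 z.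
  by rewrite mem_filter => /andP[/boolp.asboolP[a La [b _ ->]] _];
    apply: lower_central_comm.
have [||||sN sNP] := @listed_generated E S l #|gT|.
- by rewrite -cardsT cardG_gt0.
- by move=> z /lN Nz a; apply: NZ.
- move=> z lz; have := lz; rewrite mem_filter =>
  /andP[/boolp.asboolP[a La [b _ Ez]] _].
  (* As z = [a, b] is central, z^m = [a^m, b]; for m the order of E / N, a^m lies in N and is
     therefore central. *)
  have Nz := lN z lz; suff -> : z ^+ #|gT| = [~ a ^+ #|gT|, b].
    apply/eqP/commgP/NZ; rewrite -[_ ^+ _]mul1g -{1}invg1.
    by apply: NP; rewrite (homo1g fM) expQ.
  elim: #|gT| => [|m IHm]; first by rewrite !expg0 comm1g.
  by rewrite !expgS commgMl -Ez -IHm conjgE (NZ z (a ^+ m) Nz) mulKg.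
- move=> z Sz; rewrite mem_filter; apply/andP; split; first exact/boolp.asboolP.
  have [a _ [b _ ->]] := Sz; have [t Tt Nt] := TP a; have [t' Tt' Nt'] := TP b.
  apply/allpairsP; exists (t, t'); split=> //=.
  by rewrite -{1}(mulVKg t a) commNl // -{1}(mulVKg t' b) commNr.
exists [seq t * z | t <- T, z <- sN] => g; have [t Tt Nt] := TP g.
apply/allpairsP; exists (t, t^-1 * g); split=> //=; last by rewrite mulVKg.
exact: sNP.
Qed.

End Finiteness.

(** * The universal property of the quotient *)

Section Universal.
Local Open Scope group_scope.

(* Indices are shifted by one with respect to lower_central: D 0 plays the role
   of gamma_1. *)
Definition central_series (H : groupType) (D : nat -> H -> Prop) : Prop :=
  (forall n, subgroup (D n)) /\
  (forall n u v, D n u -> D 0%N v -> D n.+1 [~ u, v]).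

(* The universal property of F / gamma_{c+1}(F) among groups with a central
   series of length c. *)
Definition free_nilpotent_pair p c (G : groupType) (x y : G) : Prop :=
  forall (H : groupType) (D : nat -> H -> Prop) a b, central_series D ->
    (forall h, D c h -> h = 1) -> D 0%N a -> D 0%N b ->
    a ^+ p = 1 -> b ^+ p = 1 ->
  exists f : G -> H, [/\ {morph f : u v / u * v}, f x = a & f y = b].

Lemma quotient_free_nilpotent p c : (0 < p)%N ->
  exists (gT : finGroupType) (x y : gT),
    [/\ isomorphic_groups (nquotient (gamma (free_prod_Zp p) c.+1)) gT,
        x ^+ p = 1 /\ y ^+ p = 1,
        forall P, subgroup P -> P x -> P y -> forall g, P g,
        forall g : gT, lower_central c.+1 g -> g = 1
      & free_nilpotent_pair p c x y].
Proof.
move=> p0; set F := free_prod_Zp p; set N := gamma F c.+1; set E := nquotient N.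
pose f : F -> E := @nquotient_map F N.
have fM : {morph f : a b / a * b} by apply: nquotient_mapM.
have f_surj : forall q, exists a, f a = q by apply: nquotient_map_surj.
pose R := classical_sets.range (fun a : 'I_2 => nseq p (a, true)).
have I2 (a : 'I_2) : a = ord0 \/ a = ord_max.
  by case: a => [[|[|[]]] // lt2]; [left | right]; apply: val_inj.
pose X : F := letter R ord0; pose Y : F := letter R ord_max.
have genF (P : F -> Prop) : subgroup P -> P X -> P Y -> forall g, P g.
  by move=> sP PX PY; apply: presented_gen => // a; have [->|->] := I2 a.
have letter_p a : letter R a ^+ p = 1.
  by rewrite letterX; apply: word_class_rel; exists a.
have genE (P : E -> Prop) : subgroup P -> P (f X) -> P (f Y) -> forall g, P g.
  move=> sP PX PY g; have [a <-] := f_surj g; apply: (genF (P \o f)) => //.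
  exact: (subgroup_preim fM).
have Xp : f X ^+ p = 1 by rewrite -(homoXg fM) letter_p (homo1g fM).
have Yp : f Y ^+ p = 1 by rewrite -(homoXg fM) letter_p (homo1g fM).
have nilE (g : E) : lower_central c.+1 g -> g = 1.
  by move=> /(lower_central_surj fM f_surj)[a La <-]; apply: nquotient_map_eq1.
have [s sE] := nilpotent_listed p0 Xp Yp genE nilE.
have [gT [h h_bij hM]] := listed_group_finite sE; have [h' hK h'K] := h_bij.
have h'M : {morph h' : a b / a * b}.
  by move=> a b; apply: (bij_inj h_bij); rewrite hM !h'K.
exists gT, (h (f X)), (h (f Y)); split.
- pose hB := isMultiplicative.Build E gT h hM.
  by exists (HB.pack_for {multiplicative E -> gT} h hB).
- by rewrite -!(homoXg hM) Xp Yp (homo1g hM).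
- move=> P sP PX PY g; rewrite -[g]h'K; apply: (genE (fun a => P (h a))) => //.
  exact: (subgroup_preim hM).
- have h_surj b : exists a, h a = b by exists (h' b).
  by move=> g /(lower_central_surj hM h_surj)[a /nilE-> <-];
    rewrite (homo1g hM).
move=> H D a b [sD DR] Dc Da Db ap bp.
pose l (i : 'I_2) := if i == ord0 then a else b.
have lp i n : word_value l (nseq n (i, true)) = l i ^+ n.
  by elim: n => // n IHn; rewrite expgS -IHn.
have [|g gM gE] := @presented_lift _ R H l.
  by move=> _ [i _ <-]; rewrite lp /l; case: eqP.
(* The lift to F maps gamma_{c+1} into D c, which is trivial, and so factors through the
   quotient. *)
have gN u : nsg_set N u -> g u = 1.
  move=> Nu; apply: Dc; move: Nu; apply: (lower_central_homo gM sD) =>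
    [v|n u' v Du].
    apply: (genF (fun v => D 0%N (g v))); rewrite ?gE //.
    exact: (subgroup_preim gM).
  apply: DR => //.
  apply: (genF (fun v => D 0%N (g v))); rewrite ?gE //.
  exact: (subgroup_preim gM).
have [k kM kE] := nquotient_lift gM gN.
exists (fun z => k (h' z)); split=> [u v||]; first by rewrite h'M kM.
- by rewrite hK kE gE.
- by rewrite hK kE gE.
Qed.

End Universal.

(** * Groups of affine permutations of a ring *)

Section AffineGroup.
Local Open Scope ring_scope.
Variables (R : finNzRingType) (T : R) (p : nat).
Hypotheses (p_gt0 : (0 < p)%N) (Tp : T ^+ p = 1).
Local Notation t := (T - 1).

Lemma affine_mul_inj : injective (fun v : R => T * v).
Proof.
apply: (can_inj (g := fun v => T ^+ p.-1 * v)) => v.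
by rewrite mulrA -exprSr prednK // Tp mul1r.
Qed.

(** The semidirect product of the additive group of R by the powers of T, realised inside [{perm R}]
    to inherit a finite group structure. *)
Definition affine j a : {perm R} :=
  (perm affine_mul_inj ^+ j * perm (@addIr R a))%g.

Lemma affineE j a v : affine j a v = T ^+ j * v + a.
Proof.
rewrite permM permE; congr (_ + a); elim: j => [|j IHj];
  first by rewrite perm1 mul1r.
by rewrite expgSr permM permE IHj mulrA -exprS.
Qed.

Lemma affineM j a l b :
  (affine j a * affine l b)%g = affine (j + l) (T ^+ l * a + b).
Proof.
by apply/permP=> v; rewrite permM !affineE mulrDr mulrA -exprD addrA addnC.
Qed.

Lemma affine1 : affine 0 0 = 1%g.
Proof. by apply/permP=> v; rewrite affineE perm1 mul1r addr0. Qed.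

Lemma affine_modn j a : affine (j %% p) a = affine j a.
Proof. by apply/permP=> v; rewrite !affineE expr_mod. Qed.

Lemma affine_inj j l a b : affine j a = affine l b -> a = b.
Proof. by move/permP/(_ 0); rewrite !affineE !mulr0 !add0r. Qed.

Lemma affineX j a n :
  (affine j a ^+ n)%g = affine (j * n) ((\sum_(l < n) (T ^+ j) ^+ l) * a).
Proof.
elim: n => [|n IHn]; first by rewrite muln0 big_ord0 mul0r affine1.
rewrite expgS IHn affineM mulnS; congr affine.
by rewrite big_ord_recr /= mulrDl addrC -exprM.
Qed.

Lemma affineJ j a b : (affine 0 a ^ affine j b)%g = affine 0 (T ^+ j * a).
Proof.
apply: (mulgI (affine j b)); rewrite conjgE mulKVg !affineM addn0 add0n.
by rewrite mul1r addrC.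
Qed.

Lemma affineR j a l b :
  ([~ affine j a, affine l b])%g = affine 0 (T ^+ l * a - a - (T ^+ j * b - b)).
Proof.
apply: (mulgI (affine l b * affine j a)%g);
  rewrite -commgC !affineM addn0 mul1r addnC.
by congr affine; rewrite opprB [RHS]addrC (addrC _ a) addrACA !subrK.
Qed.

Lemma expr_sub1 j : exists2 w, T ^+ j - 1 = w * t & GRing.comm T w.
Proof.
exists (\sum_(i < j) T ^+ i); last by apply: commr_sum => i _; apply: commrX.
elim: j => [|j IHj]; first by rewrite big_ord0 mul0r subrr.
by rewrite big_ord_recr /= mulrDl -IHj mulrBr mulr1 -exprSr [RHS]addrC addrA
  subrK.
Qed.

(** Linear parts T^j occur only at level 0. A commutator with such an element applies a multiple of
    t to a translation vector, so the power of t annihilating it drops by one. *)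
Definition affine_series c n (h : {perm R}) : Prop :=
  exists j a, [/\ h = affine j a, (0 < n)%N -> j = 0%N & t ^+ (c - n) * a = 0].

Lemma comm_t w : GRing.comm T w -> GRing.comm t w.
Proof. by move=> Tw; apply/commr_sym/commrB/commr1/commr_sym. Qed.

Lemma affine_central_series c : central_series (affine_series c).
Proof.
have tT m j a : t ^+ m * a = 0 -> t ^+ m * (T ^+ j * a) = 0.
  move=> ta; rewrite mulrA (_ : t ^+ m * T ^+ j = T ^+ j * t ^+ m);
    first by rewrite -mulrA ta mulr0.
  by apply/commr_sym/commrX/commr_sym/comm_t/commrX.
have tR m j a : t ^+ m * a = 0 -> t ^+ m.-1 * (T ^+ j * a - a) = 0.
  case: m => [|m] /=.
    by rewrite expr0 !mul1r => ->; rewrite mulr0 subrr.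
  have [w Ew Tw] := expr_sub1 j => ta.
  have -> : T ^+ j * a - a = w * t * a by rewrite -Ew mulrBl mul1r.
  rewrite mulrA (_ : t ^+ m * (w * t) = w * t ^+ m.+1) -?mulrA ?ta ?mulr0 //.
  by rewrite mulrA (commr_sym (commrX m (commr_sym (comm_t Tw)))) -mulrA
    -exprSr.
have sM n h h' : affine_series c n h -> affine_series c n h' ->
  affine_series c n (h * h')%g.
  move=> [j [a [-> j0 ta]]] [l [b [-> l0 tb]]].
  exists (j + l)%N, (T ^+ l * a + b); rewrite affineM; split=> // [n0|].
    by rewrite j0 // l0.
  by rewrite mulrDr tT // tb addr0.
have s1 n : affine_series c n 1%g.
  by exists 0%N, 0; rewrite affine1 mulr0.
split=> [n|n _ _ [j [a [-> j0 ta]]] [l [b [-> _ tb]]]].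
  split=> // [h h'|h sh]; first exact: sM.
  by rewrite invg_expg; elim: #[h]%g.-1 => [|m IHm];
    [apply: s1 | rewrite expgS; apply: sM].
exists 0%N, (T ^+ l * a - a - (T ^+ j * b - b)); split=> //;
  first exact: affineR.
rewrite subnS mulrBr tR // sub0r; apply/eqP; rewrite oppr_eq0.
case: n => [|n] in j0 ta *; first by rewrite tR.
by rewrite j0 // mul1r subrr mulr0.
Qed.

Lemma affine_series_end c h : (0 < c)%N -> affine_series c c h -> h = 1%g.
Proof.
move=> c0 [j [a [-> /(_ c0)-> ]]]; rewrite subnn mul1r => ->; exact: affine1.
Qed.

(** The translation part of the p-th power is the sum of the T^(jl), l < p, applied to t a. As T is
    a power of T^j, t is a multiple of T^j - 1, and the sum times T^j - 1 is T^(jp) - 1 = 0. *)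
Lemma affine_prime j a : coprime j p -> ((affine j (t * a)) ^+ p = 1)%g.
Proof.
move=> jp; rewrite affineX -affine_modn modnMl mulrA.
suff -> : (\sum_(l < p) (T ^+ j) ^+ l) * t = 0 by rewrite mul0r affine1.
have [m Em] : exists m, (T ^+ j) ^+ m = T.
  (* Bezout gives 1 + d j divisible by p, so z = T^(jd) is the inverse of T and z^(p-1) = T. *)
  have [d _] := Bezoutr j p_gt0; rewrite (eqP jp) add1n => /dvdnP[e Ee].
  pose z := (T ^+ j) ^+ d; have zT : z * T = 1.
    by rewrite /z -exprM mulnC -exprSr Ee mulnC exprM Tp expr1n.
  exists (d * p.-1)%N; rewrite exprM -/z -[LHS]mulr1 -zT mulrA -exprSr prednK
    //.
  by rewrite /z (exprAC _ d) (exprAC _ j) Tp !expr1n mul1r.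
have -> : t = (T ^+ j - 1) * \sum_(l < m) (T ^+ j) ^+ l by rewrite -subrX1 Em.
rewrite mulrA (_ : _ * (T ^+ j - 1) = 0) ?mul0r //.
have /commr_sym -> : GRing.comm (T ^+ j - 1) (\sum_(l < p) (T ^+ j) ^+ l).
  by apply: commr_sum => l _; apply/commrX/commr_sym/commrB; [|apply: commr1].
by rewrite -subrX1 exprAC Tp expr1n subrr.
Qed.

End AffineGroup.

(** * The ring of matrices with a cyclic shift *)

Section ShiftRing.
Local Open Scope ring_scope.

Lemma ordS_permX n (i : 'I_n) j :
  ((perm (can_inj (@ordSK n)) ^+ j)%g i : nat) = ((i + j) %% n)%N.
Proof.
elim: j => [|j IHj]; first by rewrite perm1 addn0 modn_small.
by rewrite expgSr permM permE /= IHj -[in LHS]addn1 modnDml addn1 addnS.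
Qed.

Lemma perm_mxX (A : nzRingType) n (s : 'S_n.+1) j :
  (perm_mx s : 'M[A]_n.+1) ^+ j = perm_mx (s ^+ j)%g.
Proof.
by elim: j => [|j IHj]; rewrite ?perm_mx1 // exprS IHj expgS perm_mxM.
Qed.

(* R is the ring of p x p matrices over Z/p^(k+1), and T a cyclic permutation
   matrix; the (0, 0) entry of (T - 1)^(p-1) is 1 or -1. *)
Lemma shift_ring p k : prime p -> exists (R : finNzRingType) (T : R),
  [/\ T ^+ p = 1, (p ^ k.+1)%:R = 0 :> R
    & forall n, (T - 1) ^+ p.-1 *+ (n * p ^ k) = 0 -> (p %| n)%N].
Proof.
move=> p_pr; have p_gt1 := prime_gt1 p_pr; have p_gt0 := ltnW p_gt1.
have Ep := prednK p_gt0; set q := (p ^ k.+1)%N.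
have q_gt1 : (1 < q)%N by rewrite -(exp1n k.+1) ltn_exp2r.
pose s := perm (can_inj (@ordSK p.-1.+1)).
pose R := 'M['Z_q]_p.-1.+1; pose T : R := perm_mx s.
have Tn j : T ^+ j = perm_mx (s ^+ j)%g by apply: perm_mxX.
exists R, T; split.
- rewrite Tn (_ : s ^+ p = 1)%g ?perm_mx1 //.
  apply/permP=> i; apply: val_inj; rewrite /= ordS_permX perm1.
  have -> : (i + p = i + p.-1.+1)%N by congr addn.
  by rewrite modnDr modn_small.
- by apply/matrixP=> i j; rewrite mulmxnE !mxE -mulrnA mulnC mulrnA char_Zp
  ?mul0rn.
move=> n /matrixP/(_ ord0 ord0); rewrite mulmxnE [RHS]mxE.
(* In the binomial expansion only the constant term meets the (0, 0) entry, because the shift by j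
   moves 0 for 0 < j < p. *)
have -> : ((T - 1) ^+ p.-1) ord0 ord0 = (-1) ^+ p.-1.
  rewrite exprBn_comm; last exact: commr1.
  rewrite summxE big_ord_recr /= big1 ?add0r => [|i _].
    rewrite subnn binn expr0 expr1n !mulr1 mulr1n -[in LHS]signr_odd.
    by rewrite -[in RHS]signr_odd; case: (odd _); rewrite ?expr1 ?expr0 !mxE ?eqxx.
  rewrite expr1n mulr1 mulmxnE Tn -signr_odd mulr_sign.
  have E0 : (perm_mx (s ^+ (p.-1 - i))%g : R) ord0 ord0 = 0.
    rewrite !mxE -(inj_eq val_inj) /= ordS_permX add0n modn_small ?ltnS
      ?leq_subr //.
    by rewrite subn_eq0 leqNgt ltn_ord.
  by case: (odd i); rewrite ?[fun_of_matrix (- _) _ _]mxE E0 ?oppr0 mul0rn.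
rewrite -signr_odd -mulr_natr mulr_sign => E.
have {E} : ((n * p ^ k)%:R : 'Z_q) = 0 by case: (odd _) E => // /eqP;
  rewrite oppr_eq0 => /eqP.
move/(congr1 (@nat_of_ord _)); rewrite val_Zp_nat //= => /eqP;
  rewrite -/(dvdn _ _).
by rewrite /q expnS dvdn_pmul2r // expn_gt0 p_gt0.
Qed.

End ShiftRing.

(** * The Beauville structure *)

Section Palindrome.
Local Open Scope group_scope.

(** Both elements of the second pair have this form: x2 is [palindrome x y] and y2 is
    [palindrome y^-1 x]. The exponent sum is 2 in a and 0 in b. *)
Definition palindrome (G : groupType) (a b : G) : G := b * a * b ^- 2 * a * b.

Lemma palindromeV (G : groupType) (a b : G) :
  palindrome a^-1 b^-1 = (palindrome a b)^-1.
Proof. by rewrite /palindrome expVgn !invgM !mulgA. Qed.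

Lemma palindrome_homo (G H : groupType) (f : G -> H) a b :
  {morph f : u v / u * v} -> f (palindrome a b) = palindrome (f a) (f b).
Proof. by move=> fM; rewrite /palindrome !fM (homoVg fM) (homoXg fM). Qed.

Lemma palindrome_commute (G : groupType) (a b : G) :
  commute a b -> palindrome a b = a ^+ 2.
Proof.
move=> ab; transitivity (a * (b * b ^- 2 * b) * a).
  by rewrite /palindrome !mulgA -ab -[RHS](mulgA _ b a) -ab [RHS]mulgA.
by rewrite expgS expg1 invgM mulKVg mulVg mulg1.
Qed.

Lemma fin_subgroup (gT : finGroupType) (P : gT -> Prop) :
  P 1 -> (forall u v, P u -> P v -> P (u * v)) -> subgroup P.
Proof.
move=> P1 PM; split=> // u Pu; rewrite invg_expg.
by elim: #[u].-1 => [|m IHm]; [apply: P1 | rewrite expgS; apply: PM].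
Qed.

(** The universal property for the cyclic group of z with the series <z>, 1, 1, ...; these
    characters detect exponents of x and y modulo p. *)
Lemma free_nilpotent_cyclic p c (gT : finGroupType) (x y : gT)
    (Z : groupType) (z : Z) m n :
    (0 < p)%N -> (0 < c)%N -> free_nilpotent_pair p c x y ->
    (forall P, subgroup P -> P x -> P y -> forall g, P g) -> z ^+ p = 1 ->
  exists chi : gT -> Z, [/\ {morph chi : u v / u * v}, chi x = z ^+ m,
    chi y = z ^+ n & forall u v, commute (chi u) (chi v)].
Proof.
move=> p0; case: c => // c _ xy_free xy_gen zp.
pose D i h := if i is 0%N then exists e, h = z ^+ e else h = 1 :> Z.
have zV e : (z ^+ e)^-1 = z ^+ (e * p.-1).
  by apply/mulg1_eq; rewrite -expgnDr -mulnS prednK // mulnC expgnA zp expg1n.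
have zC e f : commute (z ^+ e) (z ^+ f) by apply: commuteX2;
  apply: commute_refl.
have sD : subgroup (D 0%N).
  split=> [|_ _ [e ->] [f ->]|_ [e ->]]; first by exists 0%N.
    by exists (e + f)%N; rewrite expgnDr.
  by exists (e * p.-1)%N; rewrite zV.
have zp1 e : (z ^+ e) ^+ p = 1 by rewrite -expgnA mulnC expgnA zp expg1n.
have cD : central_series D.
  split=> [[|i] //|i u v Du [f ->]]; first by split=> [|u v -> ->|u ->] /=;
    rewrite ?mulg1 ?invg1.
  by apply/eqP/commgP; case: i Du => [[e ->]|i ->];
    [apply: zC | apply/commute_sym/commute1].
have Dz e : D 0%N (z ^+ e) by exists e.
have [chi [chiM chix chiy]] :=
  xy_free Z D _ _ cD (fun _ => id) (Dz m) (Dz n) (zp1 m) (zp1 n).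
exists chi; split=> // u v.
have chiD g : D 0%N (chi g).
  apply: (xy_gen (fun g => D 0%N (chi g))); last 2 first.
  - by rewrite chix; exists m.
  - by rewrite chiy; exists n.
  exact: (subgroup_preim chiM).
by have [[e ->] [f ->]] := (chiD u, chiD v); apply: zC.
Qed.

End Palindrome.

(** * Affine representations that separate the cyclic subgroups *)

Section Models.
Local Open Scope ring_scope.
Variables (R : finNzRingType) (T : R) (p k : nat).
Hypotheses (p_pr : prime p) (p_odd : odd p) (k_gt0 : (0 < k)%N).
Hypotheses (Tp : T ^+ p = 1) (pR : (p ^ k.+1)%:R = 0 :> R).
Hypothesis (tR : forall n, (T - 1) ^+ p.-1 *+ (n * p ^ k) = 0 -> (p %| n)%N).
Let p_gt0 : (0 < p)%N := prime_gt0 p_pr.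
Local Notation t := (T - 1).
Local Notation aff := (affine p_gt0 Tp).
Local Notation S := (aff 1 0).
Local Notation c := (k * p.-1).+1.

Let p_ndvd1 : ~ (p %| 1)%N.
Proof. by rewrite dvdn1 => /eqP p1; have := prime_gt1 p_pr; rewrite p1. Qed.

(** In (1 + t)^p = T^p = 1 the middle binomial coefficients are divisible by p. *)
Lemma aug_expr_prime : exists W, t ^+ p = t * W *+ p.
Proof.
have Ep := prednK p_gt0.
exists (- \sum_(i < p.-1) t ^+ i *+ ('C(p, i.+1) %/ p)).
have := exprD1n t p.-1.+1.
rewrite big_ord_recr big_ord_recl /= !Ep subrK Tp bin0 binn expr0 !mulr1n =>
  /esym/eqP.
rewrite -addrA -[X in _ == X]addr0 (inj_eq (addrI 1)) addrC addr_eq0 => /eqP->.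
rewrite mulrN mulNrn mulr_sumr -sumrMnl; congr (- _); apply: eq_bigr => i _.
rewrite mulrnAr -exprS -mulrnA divnK //; apply: prime_dvd_bin => //=.
by rewrite -[X in (_ < X)%N]Ep ltnS.
Qed.

Lemma aug_expr_iter m : exists u, t ^+ (m * p.-1).+1 = t * u *+ p ^ m.
Proof.
have [W tp] := aug_expr_prime.
elim: m => [|m [u IHm]]; first by exists 1; rewrite mul0n expr1 mulr1.
exists (W * u); rewrite mulSn -addnS exprD IHm mulrnAr mulrA -exprSr prednK //
  tp.
by rewrite mulrnAl -mulrA -mulrnA expnS.
Qed.

Lemma mulrn_char (a : R) : a *+ p ^ k.+1 = 0.
Proof. by rewrite -mulr_natr pR mulr0. Qed.

Lemma aug_nilpotent : t ^+ (c + p.-1) = 0.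
Proof.
have [u Eu] := aug_expr_iter k.+1.
by rewrite addSn addnC -mulSn Eu mulrn_char.
Qed.

Lemma aug_socle r : t ^+ (p + r) *+ p ^ k = 0.
Proof.
have [W tp] := aug_expr_prime.
by rewrite exprD tp mulrnAl -mulrnA -expnS mulrn_char.
Qed.

Lemma affine_exp n : (S ^+ n = aff n 0)%g.
Proof. by rewrite affineX mulr0 mul1n. Qed.

Lemma order_shift : #[S]%g = p.
Proof.
apply: nt_prime_order => //.
  by rewrite affine_exp -affine_modn modnn affine1.
apply/eqP => /permP/(_ 1); rewrite affineE perm1 expr1 mulr1 addr0 => T1.
have := @tR 1%N; rewrite T1 subrr expr0n -[p.-1]prednK;
  last by rewrite -ltnS prednK // prime_gt1.
by rewrite mul0rn => /(_ erefl)/p_ndvd1.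
Qed.

Lemma affine0X a n : (aff 0 a ^+ n)%g = aff 0 (a *+ n).
Proof.
rewrite affineX mul0n (eq_bigr (fun=> 1)) ?sumr_const ?card_ord ?mulr_natl //
  => l _.
by rewrite expr0 expr1n.
Qed.

Lemma affine_eq1 a : (aff 0 a == 1%g) = (a == 0).
Proof.
apply/eqP/eqP=> [|->]; last exact: affine1.
by rewrite -(affine1 p_gt0 Tp) => /affine_inj.
Qed.

Lemma order_translation : #[aff 0 (t ^+ p.-1)]%g = (p ^ k.+1)%N.
Proof.
have : (#[aff 0 (t ^+ p.-1)]%g %| p ^ k.+1)%N.
  by rewrite order_dvdn affine0X mulrn_char affine1.
case/(dvdn_pfactor _ _ p_pr)=> m; rewrite leq_eqVlt => /predU1P[-> //|mk Em].
have : (#[aff 0 (t ^+ p.-1)]%g %| p ^ k)%N by rewrite Em dvdn_exp2l.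
rewrite order_dvdn affine0X affine_eq1 -[(p ^ k)%N]mul1n => /eqP.
by move/tR/p_ndvd1.
Qed.

Variables (gT : finGroupType) (x y : gT).
Hypotheses (xy_free : free_nilpotent_pair p c x y)
  (xy_gen : forall P : gT -> Prop, subgroup P -> P x -> P y -> forall g, P g).

(* Under x |-> (v |-> T v), y |-> (v |-> T^-1 v + t^(p-1)) the element xy
   becomes a translation of order p^(k+1), while elements outside the kernel of chi get
   order p, their translation part being divisible by t. *)
Lemma disjoint_xy : (forall g : gT, g ^+ (p ^ k.+1) = 1)%g ->
  exists chi : gT -> {perm R}, [/\ {morph chi : u v / (u * v)%g},
    chi x = S, chi y = (S ^+ p.-1)%g, forall u v, commute (chi u) (chi v)
    & forall b m n g h, chi b <> 1%g ->
        (((x * y) ^+ m) ^ g = (b ^+ n) ^ h)%g -> ((x * y) ^+ m = 1)%g].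
Proof.
move=> expG; have Sp : (S ^+ p = 1)%g by apply/eqP;
  rewrite -order_dvdn order_shift.
have Ep := prednK p_gt0.
have Ep2 : (p.-2.+1 = p.-1)%N by rewrite prednK // -ltnS Ep prime_gt1.
have [chi [chiM chix chiy chiC]] :=
  free_nilpotent_cyclic 1 p.-1 p_gt0 (ltn0Sn _) xy_free xy_gen Sp.
rewrite expg1 in chix.
set v := t ^+ p.-1; have Ev : v = t * t ^+ p.-2 by rewrite -exprS Ep2.
have [|h|||//||phi [phiM phix phiy]] :=
  xy_free (D := affine_series p_gt0 Tp c) (a := S) (b := aff p.-1 v).
- exact: affine_central_series.
- exact: affine_series_end.
- by exists 1%N, 0; rewrite mulr0.
- by exists p.-1, v; split=> //; rewrite subn0 -exprD aug_nilpotent.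
- by rewrite Ev; apply: affine_prime; rewrite -{2}Ep coprimenS.
have phi_chi g : exists j a, phi g = aff j (t * a) /\ chi g = (S ^+ j)%g.
  pose P g := exists j a, phi g = aff j (t * a) /\ chi g = (S ^+ j)%g.
  apply: (xy_gen (P := P)).
  - apply: fin_subgroup => [|u w [j [a [Eu Eu']]] [l [b [Ew Ew']]]].
      by exists 0%N, 0; rewrite (homo1g phiM) (homo1g chiM) mulr0 affine1.
    exists (j + l)%N, (T ^+ l * a + b); rewrite phiM chiM Eu Ew affineM Eu' Ew'
      expgnDr; split=> //.
    congr (aff _ _); rewrite mulrDr !mulrA; congr (_ * _ + _).
    by rewrite mulrBr mulrBl mulr1 mul1r -exprS -exprSr.
  - by exists 1%N, 0; rewrite phix chix mulr0.
  - by exists p.-1, (t ^+ p.-2); rewrite phiy chiy Ev.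
exists chi; split=> // b m n g h chib E.
have [j [a [phib chibj]]] := phi_chi b.
(* [chi] kills xy because S S^(p-1) = 1, hence kills b^n, while [chi b] has order p. *)
have pn : (p %| n)%N.
  have : chi ((b ^+ n) ^ h)%g = 1%g.
    by rewrite -E (homoJg chiM) (homoXg chiM) chiM chix chiy -expgS Ep Sp
      expg1n conj1g.
  rewrite (homoJg chiM) => /eqP; rewrite conjg_eq1 (homoXg chiM) chibj -expgnA
    -order_dvdn order_shift.
  rewrite Euclid_dvdM // => /orP[|//]; rewrite -order_shift order_dvdn -chibj
    => /eqP.
  by move/chib.
have jp : coprime j p.
  rewrite coprime_sym prime_coprime //; apply/negP=> pj; apply: chib.
  by rewrite chibj; apply/eqP; rewrite -order_dvdn order_shift.
(* As p divides n, [phi] kills b^n and so (xy)^m; since [phi] maps xy to a translation of order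
   p^(k+1), that number divides m. *)
have : phi ((b ^+ n) ^ h)%g = 1%g.
  have /dvdnP[d ->] := pn; rewrite mulnC expgnA (homoJg phiM) (homoXg phiM d)
    (homoXg phiM p).
  by rewrite phib affine_prime // expg1n conj1g.
rewrite -E (homoJg phiM) => /eqP; rewrite conjg_eq1 (homoXg phiM) phiM phix
  phiy affineM.
rewrite add1n Ep mulr0 add0r -affine_modn modnn -order_dvdn order_translation.
by case/dvdnP=> d ->; rewrite mulnC expgnA expG expg1n.
Qed.

Hypothesis xp : (x ^+ p = 1)%g.

(* Under y |-> (v |-> T v), x |-> (v |-> v + A), with t^3 A = 0 and t^2 A <> 0,
   x becomes translation by A and the palindrome becomes translation by
   (T + T^-1) A = 2 A + t^2 A, which is not a multiple of any T^j A. *)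
Lemma disjoint_x m n g h :
  ((x ^+ m) ^ g = (palindrome x y ^+ n) ^ h)%g -> (x ^+ m = 1)%g.
Proof.
move=> E; have Sp : (S ^+ p = 1)%g by apply/eqP;
  rewrite -order_dvdn order_shift.
have Ep := prednK p_gt0; have p_gt2 := odd_prime_gt2 p_odd p_pr.
(* C = p^k t^(p-1) has additive order p, whereas p A = 0 and t C = p^k t^p = 0: A generates a copy
   of F_p[t] / t^3. *)
pose A := t ^+ (p - 3) *+ p ^ k; pose B := t * A; pose C := t * B.
have Ep3 : ((p - 3).+3 = p)%N := subnKC p_gt2.
have Ep2 : (p.-2.+2 = p)%N by rewrite -Ep3.
have tC : t * C = 0.
  by rewrite /C /B /A !mulrnAr -!exprS Ep3; have := aug_socle 0; rewrite addn0.
have Cn N : C *+ N = 0 -> (p %| N)%N.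
  rewrite /C /B /A !mulrnAr -!exprS -mulrnA mulnC (_ : (p - 3).+2 = p.-1)%N;
    first exact: tR.
  by apply: succn_inj; rewrite Ep3 Ep.
have Ap : A *+ p = 0 by rewrite /A -mulrnA -expnSr mulrn_char.
have [|q|||||psi [psiM psix psiy]] :=
  xy_free (D := affine_series p_gt0 Tp c) (a := aff 0 A) (b := S).
- exact: affine_central_series.
- exact: affine_series_end.
- exists 0%N, A; split=> //; rewrite subn0 /A mulrnAr -exprD.
  have pc : (p <= c + (p - 3))%N.
    rewrite -{1}(subnKC p_gt2) leq_add2r; apply: (@leq_trans p); first by [].
    by rewrite -{1}Ep ltnS leq_pmull.
  by rewrite -(subnKC pc) aug_socle.
- by exists 1%N, 0; rewrite mulr0.
- by rewrite affine0X Ap affine1.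
- exact: Sp.
have psi_aff u : exists j a, psi u = aff j a.
  apply: (xy_gen (P := fun u => exists j a, psi u = aff j a)).
  - apply: fin_subgroup => [|u1 u2 [j [a E1]] [l [b E2]]].
      by exists 0%N, 0; rewrite (homo1g psiM) affine1.
    by exists (j + l)%N, (T ^+ l * a + b); rewrite psiM E1 E2 affineM.
  - by exists 0%N, A.
  - by exists 1%N, 0.
have psi_pal : psi (palindrome x y) = aff 0 (T ^+ p.-1 * A + T * A).
  rewrite (palindrome_homo _ _ psiM) psix psiy /palindrome.
  have -> : (S ^- 2 = aff p.-2 0)%g.
    apply/mulg1_eq; rewrite affine_exp affineM mulr0 addr0 add2n Ep2.
    by rewrite -affine_modn modnn affine1.
  rewrite !affineM (_ : 1 + 0 + p.-2 + 0 + 1 = p)%N; last first.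
    by rewrite !addn0 addn1 add1n.
  rewrite -affine_modn modnn !expr0 expr1 !mul1r !add0r !addr0.
  by rewrite mulrDr mulrA -exprS (_ : p.-2.+1 = p.-1) //; apply: succn_inj;
    rewrite Ep2 Ep.
have [[j [a psig]] [l [b psih]]] := (psi_aff g, psi_aff h).
have /affine_inj EA : aff 0 (T ^+ j * (A *+ m)) =
    aff 0 (T ^+ l * ((T ^+ p.-1 * A + T * A) *+ n)).
  have := congr1 psi E; rewrite !(homoJg psiM) !(homoXg psiM) psi_pal psix psig
    psih.
  by rewrite !affine0X !affineJ.
clearbody A; have tA X : T * X = X + t * X by rewrite mulrBl mul1r addrC subrK.
have tT N X : t * (T ^+ N * X) = T ^+ N * (t * X).
  by rewrite !mulrA; congr (_ * X); rewrite mulrBl mulrBr mul1r mulr1 -exprS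
    -exprSr.
(* J represents j - l modulo p; the equation is multiplied by T^(1-l), written with a nonnegative
   exponent. *)
pose J := (l * p.-1 + j)%N.
have {EA} E0 : T ^+ J.+1 * A *+ m = (A + T ^+ 2 * A) *+ n.
  have := congr1 ( *%R (T ^+ (l * p.-1).+1)) EA.
  rewrite mulrA -exprD addSn -/J mulrnAr => ->.
  rewrite mulrA -exprD addSn addnC -mulnS Ep mulnC exprS exprM Tp expr1n mulr1
    mulrnAr mulrDr.
  by rewrite !mulrA -exprS Ep Tp mul1r -expr2.
have TB N : T ^+ N * B = B + C *+ N.
  elim: N => [|N IHN]; first by rewrite mul1r addr0.
  rewrite exprS -mulrA IHN mulrDr tA -/C mulrnAr (tA C) tC addr0 -addrA.
  by rewrite -mulrS.
(* Multiplying by t, and then by t once more, reduces to C, whose coefficients give m = 2n modulo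
   p. *)
have E1 : (B + C *+ J.+1) *+ m = (B + C) *+ (2 * n).
  have := congr1 ( *%R t) E0; rewrite !mulrnAr mulrDr !tT -/B !TB => ->.
  by rewrite mulrnA addrA -mulr2n -mulrnDl.
have E2 : C *+ m = C *+ (2 * n).
  by have := congr1 ( *%R t) E1; rewrite !mulrnAr !mulrDr mulrnAr tC mul0rn
    addr0.
have E3 (X : R) : X *+ p = 0 -> X *+ m = X *+ (2 * n).
  move=> Xp; have Xd d : C *+ d = 0 -> X *+ d = 0.
    by case/Cn/dvdnP=> e ->; rewrite mulnC mulrnA Xp mul0rn.
  have [mn|/ltnW nm] := leqP m (2 * n).
    move: E2; rewrite -(subnKC mn) !mulrnDr => /eqP.
    by rewrite -[X in X == _]addr0 (inj_eq (addrI _)) => /eqP/esym/Xd->;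
      rewrite addr0.
  move: E2; rewrite -(subnKC nm) !mulrnDr => /eqP.
  by rewrite -[X in _ == X]addr0 (inj_eq (addrI _)) => /eqP/Xd->; rewrite addr0.
have Bp : B *+ p = 0 by rewrite -mulrnAr Ap mulr0.
have Cp : C *+ p = 0 by rewrite -mulrnAr Bp mulr0.
suff pn : (p %| n)%N.
  have : (p %| m)%N.
    by apply: Cn; rewrite E2; have /dvdnP[d ->] := pn;
      rewrite mulnA mulnC mulrnA Cp mul0rn.
  by case/dvdnP=> d ->; rewrite mulnC expgnA xp expg1n.
(* Replacing m by 2n in [E1] cancels everything except 2nJ C, so p divides J or n. *)
have /Cn : C *+ (J * (2 * n)) = 0.
  move: E1; rewrite E3; last by rewrite mulrnDl Bp -mulrnA mulnC mulrnA Cp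
    mul0rn addr0.
  rewrite mulrS addrA mulrnDl => /eqP.
  by rewrite -[X in _ == X]addr0 (inj_eq (addrI _)) -mulrnA => /eqP.
have p2 : ~~ (p %| 2)%N by rewrite gtnNdvd.
rewrite !Euclid_dvdM // (negbTE p2) /= => /orP[/dvdnP[d EJ]|//].
(* If p divides J, then [E0] reads m (A + B) = n (2 (A + B) + C), and m = 2n modulo p leaves n C =
   0. *)
have EF : (A + B) *+ m = (A + B) *+ (2 * n).
  by apply: E3; rewrite mulrnDl Ap Bp addr0.
have ET2 : A + T ^+ 2 * A = (A + B) *+ 2 + C.
  by rewrite expr2 -mulrA (tA A) mulrDr !tA -/B -/C mulr2n !addrA (addrAC A B A).
apply: Cn; move: E0; rewrite exprS EJ mulnC exprM Tp expr1n mulr1 tA -/B EF ET2.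
rewrite [RHS]mulrnDl -mulrnA => /eqP.
by rewrite -[X in X == _]addr0 (inj_eq (addrI _)) eq_sym => /eqP.
Qed.

End Models.

(** * Separation of the two generating pairs and strong reality *)

Section Conclusion.
Local Open Scope group_scope.

Lemma expg_coprime_eq1 (gT : finGroupType) (u : gT) m n :
  coprime m n -> u ^+ m = 1 -> u ^+ n = 1 -> u = 1.
Proof.
move=> /eqP mn um un; apply/eqP; rewrite -order_eq1 -dvdn1 -mn dvdn_gcd.
by rewrite !order_dvdn um un eqxx.
Qed.

Lemma expg_dvdn_eq1 (G : groupType) (u : G) m n :
  u ^+ m = 1 -> (m %| n)%N -> u ^+ n = 1.
Proof. by move=> um /dvdnP[d ->]; rewrite mulnC expgnA um expg1n. Qed.

(** This lets [disjoint_x], applied to (y^-1, x), separate y from y2. *)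
Lemma free_nilpotent_pair_rot p c (gT : finGroupType) (x y : gT) :
  free_nilpotent_pair p c x y -> free_nilpotent_pair p c y^-1 x.
Proof.
move=> xy_free H D a b cD Dc Da Db ap bp.
have Da' : D 0%N a^-1 := (@subgroupV _ (D 0%N) (cD.1 0%N) _ Da).
have [|f [fM fx fy]] := xy_free H D b a^-1 cD Dc Db Da' bp;
  first by rewrite expVgn ap invg1.
by exists f; split=> //; rewrite (homoVg fM) fy invgK.
Qed.

(** Burnside basis theorem: modulo commutators the palindromes are x^2 and y^-2, and squaring is
    invertible on elements of odd order p. *)
Lemma palindromes_gen p (gT : finGroupType) (x y : gT) :
    odd p -> p.-group [set: gT] -> x ^+ p = 1 -> y ^+ p = 1 ->
    <<[set x; y]>> = [set: gT] ->
  <<[set palindrome x y; palindrome y^-1 x]>> = [set: gT].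
Proof.
move=> p_odd pG xp yp gen_xy; set X := [set _; _].
apply: (@Phi_nongen _ [set: gT]%G); pose K := ('Phi([set: gT]%G) <*> X)%G.
have G'K : [set: gT]^`(1) \subset K.
  by rewrite /= (@Phi_joing _ p [set: gT]%G pG) -joingA joing_subl.
have nK u : u \in 'N(K).
  by have /normal_norm/subsetP := sub_der1_normal G'K (subsetT K); apply;
    rewrite inE.
have fM : {morph coset K : u v / u * v} by move=> u v; rewrite morphM.
have XK : X \subset K := joing_subr _ _.
have f1 u : u \in X -> coset K u = 1 by move/(subsetP XK)/coset_id.
have fC u v : commute (coset K u) (coset K v).
  apply/commgP/eqP; rewrite -(homoRg fM); apply/coset_id/(subsetP G'K).
  by rewrite mem_commg ?inE.
have c2p : coprime 2 p by rewrite coprime2n.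
have fx : coset K x = 1.
  apply: (@expg_coprime_eq1 _ _ 2 p) => //.
    rewrite -(palindrome_commute (fC x y)) -(palindrome_homo _ _ fM) f1 //.
    exact: set21.
  by rewrite -(homoXg fM) xp (homo1g fM).
have fy : coset K y^-1 = 1.
  apply: (@expg_coprime_eq1 _ _ 2 p) => //.
    rewrite -(palindrome_commute (fC y^-1 x)) -(palindrome_homo _ _ fM) f1 //.
    exact: set22.
  by rewrite -(homoXg fM) expVgn yp invg1 (homo1g fM).
suff TK : [set: gT] \subset K by apply/eqP; rewrite eqEsubset subsetT.
rewrite -gen_xy gen_subG subUset !sub1set.
have := coset_idr (nK y^-1) fy; rewrite groupV => ->.
by rewrite (coset_idr (nK x) fx).
Qed.

Lemma SigmaP (gT : finGroupType) (a b u : gT) : u \in Sigma [set: gT]%G a b ->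
  exists s m g, [\/ s = a, s = b | s = a * b] /\ u = (s ^+ m) ^ g.
Proof.
case/bigcupP=> g _ /[!inE]; rewrite !mem_conjg -orbA => /or3P[] /cycleP[m E].
- by exists a, m, g; rewrite -E conjgKV; split=> //; constructor 1.
- by exists b, m, g; rewrite -E conjgKV; split=> //; constructor 2.
- by exists (a * b), m, g; rewrite -E conjgKV; split=> //; constructor 3.
Qed.

Lemma Sigma1 (gT : finGroupType) (a b : gT) : 1 \in Sigma [set: gT]%G a b.
Proof. by apply/bigcupP; exists 1; rewrite ?inE // conjsg1 group1. Qed.

Lemma palindromes_Beauville p k (gT : finGroupType) (x y : gT) :
    prime p -> odd p -> (0 < k)%N -> x ^+ p = 1 -> y ^+ p = 1 ->
    (forall P, subgroup P -> P x -> P y -> forall g, P g) ->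
    (forall g : gT, g ^+ (p ^ k.+1) = 1) ->
    free_nilpotent_pair p (k * p.-1).+1 x y ->
  beauville_structure [set: gT]%G x y (palindrome x y) (palindrome y^-1 x).
Proof.
move=> p_pr p_odd k0 xp yp xy_gen expG xy_free; have p_gt0 := prime_gt0 p_pr.
have gen_xy : <<[set x; y]>> = [set: gT].
  apply/eqP; rewrite eqEsubset subsetT; apply/subsetP=> u _.
  apply: (xy_gen (fun u => u \in <<[set x; y]>>));
    rewrite ?mem_gen ?set21 ?set22 //.
  by split=> [|v w|v]; [apply: group1 | apply: groupM | rewrite groupV].
have pG : p.-group [set: gT].
  rewrite -pnat_exponent; apply: (@pnat_dvd _ (p ^ k.+1));
    last by rewrite pnatX pnat_id.
  by apply/exponentP=> u _; apply: expG.
split=> //; first exact: palindromes_gen pG xp yp gen_xy.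
have [R [T [Tp pR tR]]] := shift_ring k p_pr.
have vx := disjoint_x p_pr p_odd k0 Tp pR tR xy_free xy_gen xp.
have yx_gen (P : gT -> Prop) : subgroup P -> P y^-1 -> P x -> forall g, P g.
  by move=> sP Py Px; apply: xy_gen => //; rewrite -[y]invgK; apply: subgroupV.
have yVp : y^-1 ^+ p = 1 by rewrite expVgn yp invg1.
have vy := disjoint_x p_pr p_odd k0 Tp pR tR (free_nilpotent_pair_rot xy_free)
  yx_gen yVp.
have [chi [chiM chix chiy chiC vxy]] := disjoint_xy p_pr Tp pR tR xy_free
  xy_gen expG.
set z := affine _ _ _ _ in chix chiy.
have oz : #[z] = p := order_shift p_pr Tp tR.
have zp : z ^+ p = 1 by rewrite -oz expg_order.
have z1 n : z ^+ n = 1 -> (p %| n)%N by move/eqP; rewrite -order_dvdn oz.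
(* [fx] and [fy] are the coordinates on G / Phi(G): they read off the exponents of x and of y modulo
   p. *)
have [fx [fxM fxx fxy fxC]] := free_nilpotent_cyclic 1 0 p_gt0 (ltn0Sn _)
  xy_free xy_gen zp.
have [fy [fyM fyx fyy fyC]] := free_nilpotent_cyclic 0 1 p_gt0 (ltn0Sn _)
  xy_free xy_gen zp.
have evalC (f : gT -> {perm R}) (s : gT) m g : {morph f : u v / u * v} ->
    (forall u v, commute (f u) (f v)) -> f ((s ^+ m) ^ g) = f s ^+ m.
  by move=> fM fC; rewrite (homoJg fM) (homoXg fM); apply/conjg_fixP/commgP;
    apply: commute_sym; apply/commuteX/fC.
have z2p : (z ^+ 2) ^+ p = 1 by rewrite -expgnA mulnC expgnA zp expg1n.
have yV : y^-1 ^+ p.-1 = y.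
  by rewrite -[RHS]invgK; apply/esym/mulg1_eq; rewrite -expgS prednK.
have zV : (z ^+ p.-1)^-1 = z by apply/mulg1_eq; rewrite -expgSr prednK.
have p2 : ~~ (p %| 2)%N by rewrite gtnNdvd // odd_prime_gt2.
have z2 n : (z ^+ 2) ^+ n = 1 -> (p %| n)%N.
  by rewrite -expgnA => /z1; rewrite Euclid_dvdM // (negbTE p2).
have palE (f : gT -> {perm R}) a b : {morph f : u v / u * v} ->
    (forall u v, commute (f u) (f v)) -> f (palindrome a b) = f a ^+ 2.
  by move=> fM fC; rewrite (palindrome_homo _ _ fM) palindrome_commute.
apply/eqP; rewrite eqEsubset sub1set inE !Sigma1 !andbT; apply/subsetP=> u.
case/setIP=> /SigmaP[s [m [g [sE us]]]] /SigmaP[r [n [h [rE ur]]]]; apply/set1P.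
have E : (s ^+ m) ^ g = (r ^+ n) ^ h by rewrite -us -ur.
rewrite us; suff -> : s ^+ m = 1 by rewrite conj1g.
have := congr1 fx E; have := congr1 fy E; rewrite !evalC //.
case: sE => Es; rewrite {}Es in E us *.
- case: rE => Er; rewrite {}Er in E ur *; first by move=> _ _; apply: vx E.
    rewrite !palE // !(homoVg fyM) !(homoVg fxM) fxx fxy expg0 invg1 !expg1n
      expg1 => _ zm.
    exact: expg_dvdn_eq1 xp (z1 _ zm).
  (* For x against x2 y2, [fy] sends x to 1 and x2 y2 to z^-2, so p divides n; then [fx] shows that
     p divides m. *)
  rewrite fxM fyM !palE // (homoVg fyM) (homoVg fxM) fxx fxy fyx fyy !expg0
    invg1 !expg1 !expg1n mul1g mulg1.
  rewrite expVgn => /esym; rewrite expVgn => /eqP; rewrite invg_eq1 =>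
    /eqP/z2 pn zm.
  apply: expg_dvdn_eq1 xp (z1 _ _); rewrite zm.
  exact: expg_dvdn_eq1 z2p pn.
- case: rE => Er; rewrite {}Er in E ur *.
  + rewrite !palE // fyx fyy expg0 !expg1n expg1 => zm _.
    exact: expg_dvdn_eq1 yp (z1 _ zm).
  + by move=> _ _; rewrite -yV -expgnA; apply: vy; rewrite expgnA yV; apply: E.
  rewrite fxM fyM !palE // (homoVg fyM) (homoVg fxM) fxx fxy fyx fyy !expg0
    invg1 !expg1 !expg1n mul1g mulg1.
  move=> zm /esym/z2 pn.
  apply: expg_dvdn_eq1 yp (z1 _ _); rewrite zm !expVgn.
  by rewrite (expg_dvdn_eq1 z2p pn) invg1.
(* [chi] sends x2, y2 and x2 y2 to z^2, z^2 and z^4, all nontrivial because p is odd. *)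
move=> _ _; apply: vxy E; case: rE => ->.
- by rewrite palE // chix => /z1; apply/negP.
- by rewrite palE // (homoVg chiM) chiy zV => /z1; apply/negP.
rewrite chiM !palE // (homoVg chiM) chix chiy zV -expgnDr => /z1.
by rewrite (Euclid_dvdM 2 2) // orbb; apply/negP.
Qed.

Lemma palindromes_strongly_real p k (gT : finGroupType) (x y : gT) :
    prime p -> odd p -> (0 < k)%N -> x ^+ p = 1 -> y ^+ p = 1 ->
    (forall P, subgroup P -> P x -> P y -> forall g, P g) ->
    (forall g : gT, lower_central (k * p.-1).+2 g -> g = 1) ->
    free_nilpotent_pair p (k * p.-1).+1 x y ->
  strongly_real_beauville_group [set: gT]%G.
Proof.
move=> p_pr p_odd k_gt0 xp yp gen nil free; have p_gt0 := prime_gt0 p_pr.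
pose X u := u = x \/ u = y.
have genX H : subgroup H -> (forall u, X u -> H u) -> forall g, H g.
  by move=> sH HX; apply: gen => //; apply: HX; [left | right].
have Xp u : X u -> u ^+ p = 1 by case=> ->.
have le_c : ((k * p.-1).+1 <= k.+1 * p.-1)%N.
  by rewrite mulSn -[X in (X < _)%N]add0n ltn_add2r -ltnS prednK // prime_gt1.
have expG g := expg_nilpotent p_pr genX Xp g nil le_c.
have B := palindromes_Beauville p_pr p_odd k_gt0 xp yp gen expG free.
split.
  split; first by exists x, y; case: B.
  by exists x, y, (palindrome x y), (palindrome y^-1 x).
exists x, y, (palindrome x y), (palindrome y^-1 x); split=> //.
(* The universal property, applied to G with its own lower central series, yields the endomorphism
   inverting x and y. Its square fixes the generators, so it is an automorphism, and g1 = g2 = 1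
   serve as conjugators. *)
have [|h /nil //|||||th [thM thx thy]] :=
  free gT (fun n => @lower_central gT n.+1) x^-1 y^-1.
- split=> n; first exact: lower_central_subgroup.
  by move=> u v Lu _; apply: lower_central_comm.
- by [].
- by [].
- by rewrite expVgn xp invg1.
- by rewrite expVgn yp invg1.
have thK : involutive th.
  apply: gen; rewrite ?(thx, thy) ?(homoVg thM) ?(thx, thy) ?invgK //.
  split=> [|u v Eu Ev|u Eu]; rewrite ?(homo1g thM) ?thM ?(homoVg thM) ?Eu ?Ev //.
exists (perm (can_inj thK)), 1, 1; split;
  rewrite ?inE ?invg1 ?mul1g ?mulg1 ?permE //.
- apply/andP; split; first by apply/subsetP=> u _; rewrite inE.
  by apply/morphicP=> u v _ _; rewrite !permE thM.
- rewrite !(palindrome_homo _ _ thM) (homoVg thM) thx thy; split.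
    exact: palindromeV.
  exact: palindromeV.
Qed.

End Conclusion.

(* That the quotient is a finite group is part of the conclusion: it is
   isomorphic to the full group of some finGroupType. *)
Theorem theoremA (p k : nat) :
  prime p -> odd p -> (1 <= k)%N ->
  let i := (k * (p - 1) + 1)%N in
  exists gT : finGroupType,
    isomorphic_groups
      (nquotient (gamma (free_prod_Zp p) (i + 1))) gT
    /\ strongly_real_beauville_group [set: gT]%G.
Proof.
move=> p_pr p_odd k_gt0 i.
have -> : (i + 1)%N = (k * p.-1).+2 by rewrite /i subn1 !addn1.
have [gT [x [y [iso [xp yp] gen nil free]]]] :=
  quotient_free_nilpotent (k * p.-1).+1 (prime_gt0 p_pr).
exists gT; split=> //.
exact: palindromes_strongly_real gen nil free.
Qed.
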